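(* Let $d\ge 1$ be an integer, $\beta\in(0,1]$, $\alpha>0$ with $\alpha\beta\le 1$, and $L>0$, and put $\gamma=\frac{\beta(1+\alpha)}{2\beta+d}\in(0,1)$. Assume that $P_X$ is the uniform distribution on $\mathcal X=[0,1]^d$. There are constants $D_0>0$, $\delta_0\in(0,1)$ (the constants in the class $\mathcal F(\alpha,\beta)$) and $\tilde D_1,\tilde D_2>0$, all independent of $T$ and $M$, such that for all integers $T\ge M\ge 1$ the following holds. For every $M$-batch policy $(\Gamma,\pi)$ with horizon $T$ (whose grid $\Gamma$ may be chosen adaptively), there exists a nonparametric bandit instance in $\mathcal F(\alpha,\beta)$ (with covariate distribution $P_X$) on which $$R_T(\pi)\ \ge\ \tilde D_1\Big(\frac1M\Big)^{\tilde D_2}\, T^{\frac{1-\gamma}{1-\gamma^{M}}}.$$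
   Context: **Bandit instance.** A two-arm nonparametric bandit with horizon $T$ is given by i.i.d. random vectors $(X_t,Y_t^{(1)},Y_t^{(-1)})$, $t=1,\dots,T$, where $X_t\in\mathcal X=[0,1]^d$ has law $P_X$, $Y_t^{(k)}\in[0,1]$, and $\mathbb E[Y_t^{(k)}\mid X_t]=f^{(k)}(X_t)$ for $k\in\{1,-1\}$. Here $P_X$ has a Lebesgue density bounded below and above by positive constants. Write $f^\star(x)=\max_{k\in\{1,-1\}}f^{(k)}(x)$. **Class $\mathcal F(\alpha,\beta)$.** The set of bandit instances such that, with constants $L>0$, $D_0>0$, $\delta_0\in(0,1)$: (Smoothness) $|f^{(k)}(x)-f^{(k)}(x')|\le L\|x-x'\|_2^\beta$ for all $x,x'\in\mathcal X$ and $k\in\{1,-1\}$; (Margin) $\mathbb P_X\big(0<|f^{(1)}(X)-f^{(-1)}(X)|\le\delta\big)\le D_0\delta^\alpha$ for all $\delta\in[0,\delta_0]$. **$M$-batch policy.** A pair $(\Gamma,\pi)$ where $\Gamma=\{t_0,\dots,t_M\}$ with $0=t_0<t_1<\dots<t_{M-1}<t_M=T$, and $\pi=(\pi_t)_{t=1}^T$ is a sequence of random functions $\pi_t:\mathcal X\to\{1,-1\}$. The grid may be adaptive: $t_1$ is specified before the game, and at the end of batch $i-1$ the point $t_i$ is chosen using all information (covariates and observed rewards) up to time $t_{i-1}$. At time $t$ the arm $A_t=\pi_t(X_t)$ is pulled. Let $\Gamma(t)$ be the integer with $t_{\Gamma(t)-1}<t\le t_{\Gamma(t)}$. The rule $\pi_t$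 may depend only on the covariates $X_1,\dots,X_t$ and on the rewards $Y_l^{(A_l)}$, $1\le l\le t_{\Gamma(t)-1}$ (rewards from earlier batches). **Regret.** $R_T(\pi)=\mathbb E\big[\sum_{t=1}^T\big(f^\star(X_t)-f^{(\pi_t(X_t))}(X_t)\big)\big]$. *)

(* Defs.v *)
From HB Require Import structures.
From mathcomp Require Import all_boot all_order all_algebra.
From mathcomp Require Import all_classical all_reals all_analysis.

Set Implicit Arguments.
Unset Strict Implicit.
Unset Printing Implicit Defensive.

Import Order.TTheory GRing.Theory Num.Theory.
Import numFieldNormedType.Exports.

Local Open Scope classical_set_scope.
Local Open Scope ring_scope.

Section iid_sampling.
Context {dT : measure_display} {T : measurableType dT} {R : realType}.

Definition tuple_cons (n : nat) (z : T * n.-tuple T) : n.+1.-tuple T :=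
  [tuple of z.1 :: z.2].

Lemma measurable_tuple_cons (n : nat) :
  measurable_fun [set: T * n.-tuple T] (@tuple_cons n).
Proof.
exact: (measurable_cons (f := fst) (g := snd) measurable_fst measurable_snd).
Qed.

HB.instance Definition _ (n : nat) :=
  @isMeasurableFun.Build _ _ _ _ (@tuple_cons n) (@measurable_tuple_cons n).

(* The n-fold product measure, i.e. the law of n i.i.d. draws from P. *)
Fixpoint iid_law (P : probability T R) (n : nat) : probability (n.-tuple T) R :=
  match n with
  | 0 => \d_([tuple] : 0.-tuple T)
  | m.+1 => distribution (P \x iid_law P m)%E (@tuple_cons m)
  end.

End iid_sampling.

Section covariates.
Variables (R : realType) (d : nat).

Definition cube : set (d.-tuple R) :=
  [set x | forall i : 'I_d, 0 <= tnth x i <= 1].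

(* Euclidean; the norm that the library puts on vectors is the sup norm. *)
Definition dist2 (x y : d.-tuple R) : R :=
  Num.sqrt (\sum_(i < d) (tnth x i - tnth y i) ^+ 2).

(* [uniform_prob] lives on [measurableTypeR R], a copy of R with the same
   measurable sets; this identity map transports it to R. *)
Definition of_measurableTypeR (x : measurableTypeR R) : R := x.

HB.instance Definition _ :=
  @isMeasurableFun.Build _ _ _ _ of_measurableTypeR (@measurable_id _ _ setT).

(* Normalised Lebesgue measure on the cube, as the d-fold product of the
   uniform law on [0, 1]. *)
Definition uniform_cube : probability (d.-tuple R) R :=
  iid_law (distribution (uniform_prob (@ltr01 R)) of_measurableTypeR) d.

End covariates.

(* Arm 1 is [true], arm -1 is [false].  A data point is (X, (Y^(1), Y^(-1))). *)
Notation arm := bool (only parsing).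
Notation datum R d := ((d.-tuple R) * (R * R))%type (only parsing).

Definition reward (R : realType) (d : nat) (k : arm) (z : datum R d) : R :=
  if k then z.2.1 else z.2.2.

(* A bandit instance with covariate law PX (below always [uniform_cube], whose
   Lebesgue density on the cube is constantly 1): the law of one data point,
   the sample being T i.i.d. copies, and the regression functions.
   [instance_regression] says that regression k X is a version of E[Y^(k) | X]. *)
Record bandit_instance (R : realType) (d : nat)
    (PX : probability (d.-tuple R) R) := BanditInstance {
  instance_law : probability (datum R d) R;
  regression : arm -> d.-tuple R -> R;
  instance_covariate : forall A : set (d.-tuple R), measurable A ->
    instance_law (fst @^-1` A) = PX A;
  instance_reward01 : forall k : arm,
    instance_law [set z | 0 <= reward k z <= 1] = 1%E;
  instance_regression_measurable : forall k : arm,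
    measurable_fun [set: d.-tuple R] (regression k);
  instance_regression : forall (k : arm) (A : set (d.-tuple R)), measurable A ->
    (\int[instance_law]_(z in fst @^-1` A) (reward k z)%:E =
     \int[PX]_(x in A) (regression k x)%:E)%E
}.

Section bandit_class.
Variables (R : realType) (d : nat) (PX : probability (d.-tuple R) R).
Variable B : bandit_instance PX.

Definition best_regression (x : d.-tuple R) : R :=
  Num.max (regression B true x) (regression B false x).

Definition smooth_regression (L beta : R) : Prop :=
  forall (k : arm) (x y : d.-tuple R), cube x -> cube y ->
    `|regression B k x - regression B k y| <= L * (dist2 x y) `^ beta.

Definition margin_condition (D0 delta0 alpha : R) : Prop :=
  forall delta : R, 0 <= delta <= delta0 ->
    (PX [set x | 0 < `|regression B true x - regression B false x| <= delta]%R
      <= (D0 * delta `^ alpha)%:E)%E.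

(* The class F(alpha, beta) with constants L, D0 and delta0. *)
Definition in_class (alpha beta L D0 delta0 : R) : Prop :=
  smooth_regression L beta /\ margin_condition D0 delta0 alpha.

End bandit_class.

Section batch_policies.
Variables (R : realType) (d T : nat).
Variables (dS : measure_display) (S : measurableType dS).

Local Notation path := (T.-tuple (datum R d)).

(* Time t = 1, ..., T of the game has index t.-1 : 'I_T.  The first argument
   s : S is the internal randomisation of the learner. *)
Section play.
Variable rule : 'I_T -> S -> path -> d.-tuple R -> arm.

Definition covariate (w : path) (i : 'I_T) : d.-tuple R := (tnth w i).1.

Definition action (s : S) (w : path) (i : 'I_T) : arm :=
  rule i s w (covariate w i).

Definition observed_reward (s : S) (w : path) (i : 'I_T) : R :=
  reward (action s w i) (tnth w i).

Definition same_covariates (n : nat) (w w' : path) : Prop :=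
  forall i : 'I_T, (i < n)%N -> covariate w i = covariate w' i.

Definition same_rewards (n : nat) (s : S) (w w' : path) : Prop :=
  forall i : 'I_T, (i < n)%N -> observed_reward s w i = observed_reward s w' i.

End play.

(* The grid points and the rules are functions of the internal randomisation
   and of the whole table of data; the adaptedness fields say that they only
   use what is available: for fixed s, they agree on any two tables giving the
   same observations.  The index i : 'I_T lies in batch number j.+1, i.e.
   Gamma(i.+1) = j.+1, iff grid j <= i < grid j.+1. *)
Record batch_policy (M : nat) := BatchPolicy {
  grid : nat -> S -> path -> nat;
  rule : 'I_T -> S -> path -> d.-tuple R -> arm;
  grid_first : forall s w, grid 0%N s w = 0%N;
  grid_last : forall s w, grid M s w = T;
  grid_increasing : forall s w j, (j < M)%N -> (grid j s w < grid j.+1 s w)%N;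
  grid_one_fixed : forall s w s' w', grid 1%N s w = grid 1%N s' w';
  grid_adapted : forall j s w w', (0 < j < M)%N ->
    same_covariates (grid j s w) w w' ->
    same_rewards rule (grid j s w) s w w' ->
    grid j.+1 s w = grid j.+1 s w';
  rule_adapted : forall (i : 'I_T) j s w w', (j < M)%N ->
    (grid j s w <= i < grid j.+1 s w)%N ->
    same_covariates i.+1 w w' ->
    same_rewards rule (grid j s w) s w w' ->
    rule i s w = rule i s w';
  grid_measurable : forall j, (j <= M)%N ->
    measurable_fun [set: S * path] (fun z => grid j z.1 z.2);
  rule_measurable : forall i,
    measurable_fun [set: S * path * d.-tuple R]
      (fun z => rule i z.1.1 z.1.2 z.2)
}.

Definition path_regret (M : nat) (p : batch_policy M)
    (PX : probability (d.-tuple R) R) (B : bandit_instance PX)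
    (s : S) (w : path) : R :=
  \sum_(i < T) (best_regression B (covariate w i)
                - regression B (action (rule p) s w i) (covariate w i)).

(* The expectation is over the internal randomisation, of law nu, and the
   independent T i.i.d. data points. *)
Definition regret (nu : probability S R) (M : nat) (p : batch_policy M)
    (PX : probability (d.-tuple R) R) (B : bandit_instance PX) : \bar R :=
  ('E_(nu \x iid_law (instance_law B) T)[fun z => path_regret p B z.1 z.2])%E.

End batch_policies.

(* Main.v *)
(** The gap between the two arms is a sum of spikes, [theta c] times a bump of
    height [kappa h^beta] on a cube of side [h], with unknown signs [theta c]; the
    sides take [M] values, one for each batch.  Let [tau 0 <= ... <= tau M] be
    thresholds growing like [T^((1 - gamma^j) / (1 - gamma^M))].  On every path some
    batch starts before [tau j] and ends after [tau (j + 1)]; call this event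
    [A j].  Both [A j] and, on [A j], the arms pulled between the times [tau j] and
    [tau (j + 1)] depend only on the covariates and on the first [tau j] rewards.
    The side [h j] is chosen so small that these rewards do not reveal the sign of a
    given spike of scale [j], so on [A j] a constant fraction of the visits to the
    spikes of scale [j] costs regret.  The probabilities of the [A j] sum to at least
    one, under every instance, which selects a scale [j] with probability at least
    [1/M] on average over the instances.

    A policy could detect the scale from the data without learning any sign.  Hence,
    when [alpha beta < d], the spikes of all the scales are present at once, and the
    average is over all the signs.  When [alpha beta = d = 1] the margin condition
    only allows boundedly many spikes; then there is a single one, and the reference
    is the instance without spikes, from which it cannot be told apart. *)
Require Import Defs.
From HB Require Import structures.
From mathcomp Require Import all_boot all_order all_algebra.
From mathcomp Require Import all_classical all_reals all_analysis.
From mathcomp Require Import measurable_realfun.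
From mathcomp Require Import ring lra zify.

Set Implicit Arguments.
Unset Strict Implicit.
Unset Printing Implicit Defensive.

Import Order.TTheory GRing.Theory Num.Theory.
Import numFieldNormedType.Exports.

Local Open Scope classical_set_scope.
Local Open Scope ring_scope.

(** * Nonnegative measurable functions and i.i.d. samples *)

(** Origin of the exponent: a spike of side [h] uses about [h^(d - alpha beta)] of the mass
    permitted by the margin condition and carries mass about [h^(beta + d)]. A scale filled to its
    share therefore costs about [h^(beta (1 + alpha))] per round, up to powers of [M]. Its spikes
    stay hidden during [tau j] rounds when [h] is about [tau j^(-1 / (2 beta + d))], so the window
    up to [tau (j + 1)] costs about [tau (j + 1) / tau j^gamma]; the thresholds solve the recursion
    that makes this the same for all [j]. Origin of the powers of [M]: the chi-square error is not
    multiplied by the probability of [A j], which may be as small as [1/M], so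
    [tau j * h^(2 beta + d)] is kept below [1/M]; and the [M] scales share one margin budget.
    Rewards are Bernoulli for arm 1 and constantly [1/2] for arm -1, so that every instance has an
    explicit density with respect to fair coins. All bounds are proved for a fixed value [s] of the
    internal randomisation and for a sum over a finite family of instances. The good scale may vary
    with [s], the family does not, so a single instance can be picked after averaging over [nu]. *)

Section nonneg_measurable.
Context {dT : measure_display} {T : measurableType dT} {R : realType}.
Implicit Types f g : T -> R.

(** Bundled because Tonelli, monotonicity and additivity of the integral then require no
    integrability, and the class is closed under sums and products. *)
Definition mnn f := measurable_fun [set: T] f /\ forall x, 0 <= f x.

Lemma mnn_cst (r : R) : 0 <= r -> mnn (fun=> r).
Proof. by move=> r0; split. Qed.

Lemma mnnD f g : mnn f -> mnn g -> mnn (fun x => f x + g x).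
Proof.
by move=> [mf f0] [mg g0]; split; [exact: measurable_funD|move=> x; exact: addr_ge0].
Qed.

Lemma mnnM f g : mnn f -> mnn g -> mnn (fun x => f x * g x).
Proof.
by move=> [mf f0] [mg g0]; split; [exact: measurable_funM|move=> x; exact: mulr_ge0].
Qed.

Lemma mnn_sum (I : Type) (s : seq I) (P : pred I) (f : I -> T -> R) :
  (forall i, P i -> mnn (f i)) -> mnn (fun x => \sum_(i <- s | P i) f i x).
Proof.
move=> H; elim: s => [|i s IH].
  rewrite (_ : (fun _ => _) = fun=> 0); first exact: mnn_cst.
  by apply/funext => x; rewrite big_nil.
have [Pi|/negbTE Pi] := boolP (P i).
  rewrite (_ : (fun _ => _) = fun x => f i x + \sum_(j <- s | P j) f j x).
    by apply: mnnD => //; exact: H.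
  by apply/funext => x; rewrite big_cons Pi.
rewrite (_ : (fun _ => _) = fun x => \sum_(j <- s | P j) f j x)//.
by apply/funext => x; rewrite big_cons Pi.
Qed.

Lemma mnn_prod (I : Type) (s : seq I) (P : pred I) (f : I -> T -> R) :
  (forall i, P i -> mnn (f i)) -> mnn (fun x => \prod_(i <- s | P i) f i x).
Proof.
move=> H; elim: s => [|i s IH].
  rewrite (_ : (fun _ => _) = fun=> 1); first exact: mnn_cst.
  by apply/funext => x; rewrite big_nil.
have [Pi|/negbTE Pi] := boolP (P i).
  rewrite (_ : (fun _ => _) = fun x => f i x * \prod_(j <- s | P j) f j x).
    by apply: mnnM => //; exact: H.
  by apply/funext => x; rewrite big_cons Pi.
rewrite (_ : (fun _ => _) = fun x => \prod_(j <- s | P j) f j x)//.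
by apply/funext => x; rewrite big_cons Pi.
Qed.

Lemma mnn_sqr f : measurable_fun [set: T] f -> mnn (fun x => f x ^+ 2).
Proof. by move=> mf; split; [exact: measurable_funX|move=> x; exact: sqr_ge0]. Qed.

Lemma mnn_bool (b : T -> bool) :
  measurable_fun [set: T] b -> mnn (fun x => (b x)%:R).
Proof.
move=> mb; split; last by move=> x; exact: ler0n.
rewrite [X in measurable_fun _ X](_ : _ = fun x => if b x then 1 else 0).
  exact: measurable_fun_ifT.
by apply/funext => x; case: (b x).
Qed.

Lemma mnn_EFin f : mnn f -> measurable_fun [set: T] (fun x => (f x)%:E).
Proof. by move=> [mf _]; exact/measurable_EFinP. Qed.

Variable P : {measure set T -> \bar R}.
Local Open Scope ereal_scope.

Lemma mnn_integralD f g : mnn f -> mnn g ->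
  \int[P]_x ((f x + g x)%R)%:E = \int[P]_x (f x)%:E + \int[P]_x (g x)%:E.
Proof.
move=> [mf f0] [mg g0]; rewrite -ge0_integralD//.
- by move=> x _; rewrite lee_fin.
- exact/measurable_EFinP.
- by move=> x _; rewrite lee_fin.
- exact/measurable_EFinP.
Qed.

Lemma mnn_integralZ (c : R) f : (0 <= c)%R -> mnn f ->
  \int[P]_x ((c * f x)%R)%:E = c%:E * \int[P]_x (f x)%:E.
Proof.
move=> c0 [mf f0]; rewrite -ge0_integralZl//.
- exact/measurable_EFinP.
- by move=> x _; rewrite lee_fin.
Qed.

Lemma mnn_integral_sum (I : Type) (s : seq I) (Q : pred I) (f : I -> T -> R) :
  (forall i, Q i -> mnn (f i)) ->
  \int[P]_x (\sum_(i <- s | Q i) f i x)%:E = \sum_(i <- s | Q i) \int[P]_x (f i x)%:E.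
Proof.
move=> H; elim: s => [|i s IH].
  under eq_integral do rewrite big_nil.
  by rewrite big_nil integral0.
under eq_integral do rewrite big_cons.
rewrite big_cons; case: ifPn => // Qi.
by rewrite mnn_integralD ?IH//; [exact: H|exact: mnn_sum].
Qed.

Lemma mnn_integral_le f g : mnn f -> mnn g -> (forall x, f x <= g x)%R ->
  \int[P]_x (f x)%:E <= \int[P]_x (g x)%:E.
Proof.
move=> [mf f0] [mg g0] fg; apply: ge0_le_integral => //.
- by move=> x _; rewrite lee_fin.
- exact/measurable_EFinP.
- exact/measurable_EFinP.
- by move=> x _; rewrite lee_fin.
Qed.

Lemma mnn_integral_ge0 f : mnn f -> 0 <= \int[P]_x (f x)%:E.
Proof. by move=> [_ f0]; apply: integral_ge0 => x _; rewrite lee_fin. Qed.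

End nonneg_measurable.

Lemma mnn_comp {d1 d2 : measure_display} {T1 : measurableType d1}
    {T2 : measurableType d2} {R : realType} (f : T2 -> R) (h : T1 -> T2) :
  mnn f -> measurable_fun [set: T1] h -> mnn (fun x => f (h x)).
Proof.
by move=> [mf f0] mh; split => //; exact: (measurableT_comp mf mh).
Qed.

Section iid.
Context {dT : measure_display} {T : measurableType dT} {R : realType}.
Local Open Scope ereal_scope.

Lemma tnth_tuple_cons0 n (z : T) (w : n.-tuple T) : tnth (tuple_cons (z, w)) ord0 = z.
Proof. by []. Qed.

Lemma tnth_tuple_consS n (z : T) (w : n.-tuple T) i :
  tnth (tuple_cons (z, w)) (lift ord0 i) = tnth w i.
Proof. by rewrite tnthS; congr tnth; apply/val_inj. Qed.

Lemma measurable_tuple_cons1 n (z : T) :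
  measurable_fun [set: n.-tuple T] (fun w => tuple_cons (z, w)).
Proof. exact: (measurableT_comp (@measurable_tuple_cons _ T n)). Qed.

Variable P : probability T R.

Lemma integral_iidS n (F : n.+1.-tuple T -> \bar R) :
  measurable_fun [set: _] F -> (forall w, 0 <= F w) ->
  \int[iid_law P n.+1]_w F w = \int[P]_z \int[iid_law P n]_w F (tuple_cons (z, w)).
Proof.
move=> mF F0; rewrite /= ge0_integral_distribution//.
rewrite (@fubini_tonelli1 _ _ _ _ _ P (iid_law P n))//.
  exact: (measurableT_comp mF (@measurable_tuple_cons _ T n)).
by move=> x; exact: F0.
Qed.

Lemma integral_iid0 (F : 0.-tuple T -> \bar R) :
  \int[iid_law P 0]_w F w = F [tuple].
Proof.
rewrite /= integral_dirac//; first by rewrite diracT mul1e.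
rewrite (_ : F = cst (F [tuple])); first exact: measurable_cst.
by apply/funext => w; rewrite tuple0.
Qed.

Lemma integral_iid_prod n (u : 'I_n -> T -> R) : (forall k, mnn (u k)) ->
  \int[iid_law P n]_w (\prod_(k < n) u k (tnth w k))%:E =
  \prod_(k < n) \int[P]_z (u k z)%:E.
Proof.
elim: n u => [|n IH] u hu.
  by rewrite integral_iid0 !big_ord0.
have mprod m (v : 'I_m -> T -> R) : (forall k, mnn (v k)) ->
    mnn (fun w : m.-tuple T => (\prod_(k < m) v k (tnth w k))%R).
  by move=> hv; apply: mnn_prod => k _; apply: (mnn_comp (hv k)); exact: measurable_tnth.
rewrite integral_iidS; last 2 first.
- by apply: mnn_EFin; exact: mprod.
- by move=> w; rewrite lee_fin; apply: (mprod _ u hu).2.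
rewrite big_ord_recl/=.
under eq_integral => z _.
  under eq_integral => w _.
    rewrite big_ord_recl tnth_tuple_cons0.
    under eq_bigr do rewrite tnth_tuple_consS.
    over.
  rewrite mnn_integralZ; last 2 first.
  - exact: (hu ord0).2.
  - exact: (mprod _ (fun k => u (lift ord0 k))).
  rewrite (IH (fun k => u (lift ord0 k)))//.
  over.
rewrite ge0_integralZr//.
- exact: mnn_EFin.
- by move=> z _; rewrite lee_fin; exact: (hu ord0).2.
- elim/big_ind: _ => //; first by move=> *; exact: mule_ge0.
  by move=> k _; exact: mnn_integral_ge0.
Qed.

End iid.

(** * Change of measure and resampling in i.i.d. samples *)

Section iid_change.
Context {dT : measure_display} {T : measurableType dT} {R : realType}.
Local Open Scope ereal_scope.
Variable P : probability T R.

(** Densities tensorise: by induction on [n], the first coordinate is peeled off, the outer integral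
    is changed by [hQ] and the inner one by the induction hypothesis. The density is given in
    integral form, as this is how it is computed for Bernoulli rewards. *)
Lemma integral_iid_density n (Q : probability T R) (g : T -> R)
    (F : n.-tuple T -> \bar R) : mnn g ->
  (forall h : T -> \bar R, measurable_fun [set: T] h -> (forall z, 0 <= h z) ->
    \int[Q]_z h z = \int[P]_z ((g z)%:E * h z)) ->
  measurable_fun [set: _] F -> (forall w, 0 <= F w) ->
  \int[iid_law Q n]_w F w =
  \int[iid_law P n]_w ((\prod_(k < n) g (tnth w k))%:E * F w).
Proof.
move=> hg hQ; have mprod m :
    mnn (fun w : m.-tuple T => (\prod_(k < m) g (tnth w k))%R).
  by apply: mnn_prod => k _; apply: (mnn_comp hg); exact: measurable_tnth.
elim: n F => [|n IH] F mF F0.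
  by rewrite /= !integral_dirac ?big_ord0 ?mul1e//;
    apply: (@eq_measurable_fun _ _ _ _ _ (cst (F [tuple]))) => //;
    move=> w _; rewrite (tuple0 w) ?big_ord0 ?mul1e.
have mFz z : measurable_fun [set: _] (fun w => F (tuple_cons (z, w))).
  exact: (measurableT_comp mF (measurable_tuple_cons1 z)).
have Fg0 m (w : m.-tuple T) x : 0 <= x -> 0 <= (\prod_(k < m) g (tnth w k))%:E * x.
  by move=> x0; apply: mule_ge0 => //; rewrite lee_fin; exact: (mprod m).2.
rewrite [RHS]integral_iidS; last 2 first.
- by apply: emeasurable_funM => //; exact: (mnn_EFin (mprod n.+1)).
- by move=> w; exact: Fg0.
rewrite integral_iidS//.
under eq_integral do rewrite IH//.
rewrite hQ; last 2 first.
- apply: (@measurable_fun_fubini_tonelli_F _ _ _ _ _ (iid_law P n)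
  (fun zw : T * n.-tuple T => (\prod_(k < n) g (tnth zw.2 k))%:E * F (tuple_cons zw))) => //.
  + apply: emeasurable_funM.
      by apply/measurable_EFinP; apply: (measurableT_comp (mprod n).1).
    exact: (measurableT_comp mF (@measurable_tuple_cons _ T n)).
  + by move=> x; exact: Fg0.
- by move=> z; apply: integral_ge0 => w _; exact: Fg0.
apply: eq_integral => z _; rewrite -ge0_integralZl//.
- apply: eq_integral => w _; rewrite big_ord_recl tnth_tuple_cons0.
  under [in RHS]eq_bigr do rewrite tnth_tuple_consS.
  by rewrite muleA -EFinM.
- by apply: emeasurable_funM => //; exact: (mnn_EFin (mprod n)).
- by move=> w _; exact: Fg0.
- by rewrite lee_fin; exact: hg.2.
Qed.

Definition set_tnth n (i : 'I_n) (w : n.-tuple T) (z : T) : n.-tuple T :=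
  [tuple if k == i then z else tnth w k | k < n].

Lemma tnth_set_tnth n (i : 'I_n) (w : n.-tuple T) (z : T) k :
  tnth (set_tnth i w z) k = if k == i then z else tnth w k.
Proof. by rewrite tnth_mktuple. Qed.

Lemma measurable_set_tnth n (i : 'I_n) :
  measurable_fun [set: n.-tuple T * T] (fun wz => set_tnth i wz.1 wz.2).
Proof.
apply/measurable_fun_tnthP => k.
apply: (@eq_measurable_fun _ _ _ _ _ (fun wz => if k == i then wz.2 else tnth wz.1 k)).
  by move=> wz _; rewrite /= tnth_set_tnth.
case: (k == i); first exact: measurable_snd.
exact: (measurableT_comp (measurable_tnth k) measurable_fst).
Qed.

Lemma set_tnth_cons0 n (y z : T) (w : n.-tuple T) :
  set_tnth ord0 (tuple_cons (y, w)) z = tuple_cons (z, w).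
Proof.
apply: eq_from_tnth => k; rewrite tnth_set_tnth.
case: (unliftP ord0 k) => [j ->|->]; last by rewrite eqxx.
by rewrite !tnth_tuple_consS.
Qed.

Lemma set_tnth_consS n i (y z : T) (w : n.-tuple T) :
  set_tnth (lift ord0 i) (tuple_cons (y, w)) z = tuple_cons (y, set_tnth i w z).
Proof.
apply: eq_from_tnth => k; rewrite tnth_set_tnth.
case: (unliftP ord0 k) => [j ->|->] //.
by rewrite !tnth_tuple_consS tnth_set_tnth (inj_eq (@lift_inj _ _)).
Qed.

(** A fresh draw of coordinate [i] preserves the product law. This isolates one round: with [w]
    frozen, only the law of a single data point remains. At the first coordinate the old draw
    becomes idle and Tonelli exchanges the two integrals. *)
Lemma integral_iid_resample n (i : 'I_n) (F : n.-tuple T -> \bar R) :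
  measurable_fun [set: _] F -> (forall w, 0 <= F w) ->
  \int[iid_law P n]_w F w = \int[iid_law P n]_w \int[P]_z F (set_tnth i w z).
Proof.
elim: n i F => [[]//|n IH] i F mF F0.
rewrite [RHS]integral_iidS; last 2 first.
- apply: (@measurable_fun_fubini_tonelli_F _ _ _ _ _ P
    (fun wz => F (set_tnth i wz.1 wz.2))) => //.
  exact: (measurableT_comp mF (measurable_set_tnth i)).
- by move=> w; exact: integral_ge0.
rewrite integral_iidS//.
case: (unliftP ord0 i) => [j ->|->].
  apply: eq_integral => y _.
  under [RHS]eq_integral do under eq_integral do rewrite set_tnth_consS.
  apply: (IH j (fun w => F (tuple_cons (y, w)))) => //.
  exact: (measurableT_comp mF (measurable_tuple_cons1 y)).
under [RHS]eq_integral do under eq_integral do under eq_integral do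
  rewrite set_tnth_cons0.
rewrite [RHS]integral_cst// [X in _ * X]probability_setT mule1.
apply: (@fubini_tonelli _ _ _ _ _ P (iid_law P n) (fun zw => F (tuple_cons zw))).
  exact: (measurableT_comp mF (@measurable_tuple_cons _ T n)).
by move=> zw; exact: F0.
Qed.

End iid_change.

(** * Bernoulli bandit instances *)

Section uniform01.
Variable R : realType.
Local Open Scope ereal_scope.

Definition unif01 :=
  distribution (uniform_prob (@ltr01 R)) (@of_measurableTypeR R).

Lemma unif01E (A : set R) : measurable A ->
  unif01 A = lebesgue_measure (A `&` `[0%R, 1%R]).
Proof.
move=> mA; rewrite /unif01 /distribution /pushforward /= /uniform_prob.
rewrite integral_uniform_pdf (eq_integral (cst 1)).
  by rewrite integral_cst ?mul1e//; exact: measurableI.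
move=> x; rewrite inE => -[_]; rewrite /= in_itv/= /uniform_pdf => ->.
by rewrite subr0 invr1.
Qed.

Lemma unif01_lt (p : R) : (0 <= p <= 1)%R -> unif01 [set u | (u < p)%R] = p%:E.
Proof.
move=> /andP[p0 p1].
have -> : [set u | (u < p)%R] = `]-oo, p[%classic.
  by apply/seteqP; split => u; rewrite /= in_itv.
rewrite unif01E//.
have -> : `]-oo, p[%classic `&` `[0%R, 1%R] = `[0%R, p[%classic :> set R.
  apply/seteqP; split => u /=; rewrite !in_itv/=.
    by move=> [up /andP[u0 _]]; rewrite u0.
  by move=> /andP[u0 up]; rewrite up u0; split=> //; exact: ltW (lt_le_trans up p1).
rewrite lebesgue_measure_itv/= lte_fin; case: ltP => [_|p0'].
  by rewrite -EFinB subr0.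
by congr EFin; apply/le_anti; rewrite p0 p0'.
Qed.

Lemma unif01_oo (a b : R) : (0 <= a)%R -> (b <= 1)%R -> (a <= b)%R ->
  unif01 [set u | (a < u < b)%R] = (b - a)%:E.
Proof.
move=> a0 b1 ab.
have -> : [set u | (a < u < b)%R] = `]a, b[%classic.
  by apply/seteqP; split => u; rewrite /= in_itv.
rewrite unif01E//.
have -> : `]a, b[%classic `&` `[0%R, 1%R] = `]a, b[%classic :> set R.
  apply/setIidPl => u /=; rewrite !in_itv/= => /andP[au ub].
  by rewrite (ltW (le_lt_trans a0 au)) (ltW (lt_le_trans ub b1)).
rewrite lebesgue_measure_itv/= lte_fin; case: ltP => [_|ba].
  by rewrite -EFinB.
by congr EFin; apply/esym/eqP; rewrite subr_eq0 eq_le ab ba.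
Qed.

Lemma integral_unif01_lt (p : R) (F : bool -> \bar R) : (0 <= p <= 1)%R ->
  (forall b, 0 <= F b) ->
  \int[unif01]_u F (u < p)%R = p%:E * F true + (1 - p)%:E * F false.
Proof.
move=> p01 F0.
have mA : measurable [set u | (u < p)%R].
  have -> : [set u | (u < p)%R] = `]-oo, p[%classic.
    by apply/seteqP; split => u; rewrite /= in_itv.
  exact: measurable_itv.
rewrite -(setUv [set u | (u < p)%R]) ge0_integral_setU//; last 3 first.
- exact: measurableC.
- rewrite setUv; apply: (@measurableT_comp _ _ _ _ _ _ F) => //.
  exact: measurable_fun_ltr.
- by rewrite disj_set2E setICr.
rewrite (eq_integral (cst (F true))); last first.
  by move=> u; rewrite inE /= => ->.
rewrite [X in _ + X](eq_integral (cst (F false))); last first.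
  by move=> u; rewrite inE /= => /negP/negbTE ->.
rewrite !integral_cst//; last exact: measurableC.
rewrite [X in X + _]muleC [X in _ + X]muleC; congr (_ * _ + _ * _).
  exact: unif01_lt.
rewrite [LHS]probability_setC// EFinB; congr (_ - _)%E; exact: unif01_lt.
Qed.

End uniform01.

Section bernoulli_instance.
Variables (R : realType) (d : nat) (PX : probability (d.-tuple R) R).
Implicit Type f : d.-tuple R -> R.
Local Open Scope ereal_scope.

(** [xu.2] is a uniform seed: for [f] bounded by [2^-1], arm 1 pays a Bernoulli reward of mean
    [2^-1 + f x], while arm -1 always pays [2^-1] and so reveals nothing. Thus [f] is the gap
    between the arms. *)
Definition datum_of f (xu : d.-tuple R * R) : datum R d :=
  (xu.1, ((xu.2 < 2^-1 + f xu.1)%R%:R%R, 2^-1%R)).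

Lemma measurable_datum_of f : measurable_fun [set: d.-tuple R] f ->
  measurable_fun [set: d.-tuple R * R] (datum_of f).
Proof.
move=> mf.
have mb : measurable_fun [set: d.-tuple R * R]
    (fun xu => (xu.2 < 2^-1 + f xu.1)%R%:R%R : R).
  apply: (mnn_bool _).1; apply: measurable_fun_ltr => //.
  by apply: measurable_funD => //; exact: measurableT_comp.
exact: (measurable_fun_pair measurable_fst (measurable_fun_pair mb (measurable_cst _))).
Qed.

Definition bern_law f (mf : measurable_fun [set: d.-tuple R] f) :
    probability (datum R d) R :=
  let mixin := isMeasurableFun.Build _ _ _ _ _ (measurable_datum_of mf) in
  let pack : {mfun _ >-> _} := HB.pack (datum_of f) mixin in
  distribution (PX \x @unif01 R) pack.

Definition obs (x : d.-tuple R) (b : bool) : datum R d := (x, (b%:R%R, 2^-1%R)).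

Lemma integral_bern f (mf : measurable_fun [set: d.-tuple R] f) (F : datum R d -> \bar R) :
  (forall x, `|f x| <= 2^-1)%R -> measurable_fun [set: datum R d] F ->
  (forall z, 0 <= F z) ->
  \int[bern_law mf]_z F z =
  \int[PX]_x ((2^-1 + f x)%:E * F (obs x true) + (2^-1 - f x)%:E * F (obs x false)).
Proof.
move=> f12 mF F0; rewrite ge0_integral_distribution//=.
rewrite (@fubini_tonelli1 _ _ _ _ _ PX (@unif01 R))//; last exact: (measurableT_comp mF (measurable_datum_of mf)).
apply: eq_integral => x _; rewrite /fubini_F/= /datum_of/=.
rewrite (integral_unif01_lt (F := fun b => F (obs x b)))//.
  by congr (_ + _%:E * _); lra.
by have := f12 x; rewrite ler_norml; lra.
Qed.


Lemma reward_obs k x b : reward k (obs x b) = (if k then b%:R else 2^-1)%R :> R.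
Proof. by case: k. Qed.

Lemma reward_datum_of f k xu :
  reward k (datum_of f xu) = (if k then (xu.2 < 2^-1 + f xu.1)%R%:R else 2^-1)%R :> R.
Proof. by case: k. Qed.

Lemma measurable_reward k : measurable_fun [set: datum R d] (reward k).
Proof.
by case: k; apply: (@measurableT_comp _ _ _ _ _ _ _ _ snd) => //.
Qed.

Lemma bern_law_covariate f (mf : measurable_fun [set: d.-tuple R] f)
    (A : set (d.-tuple R)) : measurable A -> bern_law mf (fst @^-1` A) = PX A.
Proof.
move=> mA; rewrite /bern_law /distribution /pushforward /=.
rewrite (_ : _ @^-1` _ = A `*` setT); last first.
  by apply/seteqP; split => -[x u] //=; case.
by rewrite product_measure1E// [X in _ * X]probability_setT mule1.
Qed.

Lemma bern_law_reward01 f (mf : measurable_fun [set: d.-tuple R] f) k :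
  bern_law mf [set z | (0 <= reward k z <= 1)%R] = 1.
Proof.
rewrite /bern_law /distribution /pushforward /=.
rewrite (_ : _ @^-1` _ = setT); first exact: probability_setT.
apply/seteqP; split => // xu _ /=; rewrite reward_datum_of.
by case: k; [case: (_ < _)%R; rewrite /= ?lexx ?ler01|lra].
Qed.

Definition bern_regression f (k : arm) (x : d.-tuple R) : R :=
  (if k then 2^-1 + f x else 2^-1)%R.

Lemma measurable_bern_regression f k : measurable_fun [set: d.-tuple R] f ->
  measurable_fun [set: d.-tuple R] (bern_regression f k).
Proof.
move=> mf; case: k; last exact: measurable_cst.
by apply: (@measurable_funD _ _ _ _ (cst 2^-1%R) f).
Qed.

Lemma bern_law_regression f (mf : measurable_fun [set: d.-tuple R] f)
    (f12 : forall x, (`|f x| <= 2^-1)%R) k (A : set (d.-tuple R)) : measurable A ->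
  \int[bern_law mf]_(z in fst @^-1` A) (reward k z)%:E =
  \int[PX]_(x in A) (bern_regression f k x)%:E.
Proof.
move=> mA.
have mfA : measurable (fst @^-1` A : set (datum R d)).
  by rewrite -[X in measurable X]setTI; exact: measurable_fst.
(* The reward may be negative off the support of the law, so the integral is split into its two
   parts; the negative part vanishes at the points [obs x b]. *)
rewrite integral_mkcond integralE.
set h := (fun z : datum R d => _) \_ _.
have mh : measurable_fun setT h.
  apply/measurable_restrict => //; rewrite setTI.
  by apply/measurable_EFinP; apply: measurable_funTS; exact: measurable_reward.
have hE x b : h (obs x b) = ((x \in A)%:R * (if k then b%:R else 2^-1))%:E.
  rewrite /h patchE reward_obs (_ : (obs x b \in _) = (x \in A)).
    by case: (x \in A); rewrite ?mul1r ?mul0r.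
  by apply/idP/idP; rewrite !inE.
have h0 x b : 0 <= h (obs x b).
  by rewrite hE lee_fin mulr_ge0//; case: k {h mh hE} => //; rewrite invr_ge0.
rewrite integral_bern//; [|exact: measurable_funepos].
rewrite integral_bern//; [|exact: measurable_funeneg].
rewrite [X in _ - X]integral0_eq; last first.
  move=> x _; have e b : h^\- (obs x b) = 0.
    by rewrite funenegE; apply/max_idPr; rewrite oppe_le0.
  by rewrite !e !mule0 adde0.
rewrite sube0 [RHS]integral_mkcond; apply: eq_integral => x _.
rewrite patchE.
have e b : h^\+ (obs x b) = h (obs x b) by rewrite funeposE; apply/max_idPl.
rewrite !e !hE -!EFinM -EFinD /bern_regression.
by case: k {h mh hE h0 e}; case: (x \in A) => //=; congr EFin; lra.
Qed.

Definition bern_instance f (mf : measurable_fun [set: d.-tuple R] f)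
    (f12 : forall x, (`|f x| <= 2^-1)%R) : bandit_instance PX :=
  BanditInstance (bern_law_covariate mf) (bern_law_reward01 mf)
    (fun k => measurable_bern_regression k mf) (bern_law_regression mf f12).

Definition sg (z : datum R d) : R := (if 2^-1 < z.2.1 then 1 else -1)%R.

Lemma sg_obs x b : sg (obs x b) = (if b then 1 else -1)%R.
Proof.
rewrite /sg /obs /=; case: b => /=.
  by rewrite ifT// invf_lt1// ltr1n.
by rewrite ifF//; apply/negbTE; rewrite -leNgt invr_ge0.
Qed.

Lemma measurable_sg : measurable_fun [set: datum R d] sg.
Proof.
apply: measurable_fun_ifT => //; apply: measurable_fun_ltr => //.
by apply: (@measurableT_comp _ _ _ _ _ _ _ _ snd) => //.
Qed.

(** For [f] bounded by [2^-1], this is the density of the law with gap [f] with respect to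
    [fair_law]: [2^-1 + f x] and [2^-1 - f x] divided by [2^-1], the sign being read off from the
    reward of arm 1. *)
Definition dens f (z : datum R d) : R := (1 + 2 * sg z * f z.1)%R.

Lemma mnn_dens f : measurable_fun [set: d.-tuple R] f ->
  (forall x, (`|f x| <= 2^-1)%R) -> mnn (dens f).
Proof.
move=> mf f12; split; last first.
  move=> z; have := f12 z.1; rewrite ler_norml /dens /sg; case: ifP => _; lra.
apply: measurable_funD => //; apply: measurable_funM.
  by apply: measurable_funM => //; exact: measurable_sg.
exact: (measurableT_comp mf measurable_fst).
Qed.

Definition fair_law : probability (datum R d) R :=
  bern_law (@measurable_cst _ _ (d.-tuple R) R setT 0%R).

Lemma integral_fair (F : datum R d -> \bar R) :
  measurable_fun [set: datum R d] F -> (forall z, 0 <= F z) ->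
  \int[fair_law]_z F z =
  \int[PX]_x (2^-1%:E * F (obs x true) + 2^-1%:E * F (obs x false)).
Proof.
move=> mF F0; rewrite integral_bern//; last first.
  by move=> x; rewrite normr0 invr_ge0.
by apply: eq_integral => x _; rewrite /= addr0 subr0.
Qed.

Lemma integral_bern_fair f (mf : measurable_fun [set: d.-tuple R] f)
    (F : datum R d -> \bar R) : (forall x, `|f x| <= 2^-1)%R ->
  measurable_fun [set: datum R d] F -> (forall z, 0 <= F z) ->
  \int[bern_law mf]_z F z = \int[fair_law]_z ((dens f z)%:E * F z).
Proof.
move=> f12 mF F0; have hg := mnn_dens mf f12.
rewrite integral_bern// integral_fair//; last 2 first.
- by apply: emeasurable_funM => //; exact: mnn_EFin.
- by move=> z; apply: mule_ge0 => //; rewrite lee_fin; exact: hg.2.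
apply: eq_integral => x _; rewrite !muleA -!EFinM /dens !sg_obs.
by congr (_%:E * _ + _%:E * _); rewrite /=; field.
Qed.

(** At a fixed covariate the values [1 + 2 * f x] and [1 - 2 * f x] of the density average to one.
    Hence a round whose reward is not read contributes no likelihood factor. *)
Lemma integral_fair_dens f (mf : measurable_fun [set: d.-tuple R] f)
    (F : datum R d -> \bar R) : (forall x, `|f x| <= 2^-1)%R ->
  measurable_fun [set: datum R d] F -> (forall z, 0 <= F z) ->
  (forall x, F (obs x true) = F (obs x false)) ->
  \int[fair_law]_z ((dens f z)%:E * F z) = \int[fair_law]_z F z.
Proof.
move=> f12 mF F0 Fb; have hg := mnn_dens mf f12.
rewrite !integral_fair//; last 2 first.
- by apply: emeasurable_funM => //; exact: mnn_EFin.
- by move=> z; apply: mule_ge0 => //; rewrite lee_fin; exact: hg.2.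
apply: eq_integral => x _; rewrite !muleA -!EFinM Fb -!ge0_muleDl ?lee_fin//.
- by congr (_ * _); rewrite -!EFinD /dens !sg_obs/=; congr EFin; field.
- by apply: mulr_ge0; [rewrite invr_ge0|exact: hg.2].
- by apply: mulr_ge0; [rewrite invr_ge0|exact: hg.2].
Qed.

Lemma integral_fair_covariate (u : d.-tuple R -> R) : mnn u ->
  \int[fair_law]_z (u z.1)%:E = \int[PX]_x (u x)%:E.
Proof.
move=> hu; rewrite integral_fair//.
- apply: eq_integral => x _; rewrite -ge0_muleDl ?lee_fin ?invr_ge0//.
  by rewrite -EFinD (_ : 2^-1 + 2^-1 = 1)%R ?mul1e//; lra.
- by apply: mnn_EFin; apply: (mnn_comp hu).
- by move=> z; rewrite lee_fin; exact: hu.2.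
Qed.

End bernoulli_instance.

(** * Likelihood ratios *)

Section likelihood.
Variables (R : realType) (d : nat) (PX : probability (d.-tuple R) R) (N : nat).
Local Notation path := (N.-tuple (datum R d)).
Local Notation fair := (iid_law (fair_law PX) N).
Implicit Types (f : d.-tuple R -> R) (w : path).

Definition lik f (n : nat) w : R := \prod_(k < N | (k < n)%N) dens f (tnth w k).

Lemma measurable_covariate (i : 'I_N) :
  measurable_fun [set: path] (fun w => (tnth w i).1).
Proof. exact: (measurableT_comp measurable_fst (measurable_tnth i)). Qed.

Lemma mnn_lik f n : measurable_fun [set: d.-tuple R] f ->
  (forall x, `|f x| <= 2^-1) -> mnn (lik f n).
Proof.
move=> mf f12; apply: mnn_prod => k _; apply: (mnn_comp (mnn_dens mf f12)).
exact: measurable_tnth.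
Qed.

Definition agree_below (n : nat) w w' := forall k : 'I_N, (k < n)%N -> tnth w k = tnth w' k.

Definition agree_covariates w w' := forall k : 'I_N, (tnth w k).1 = (tnth w' k).1.

Lemma lik_agree f n w w' : agree_below n w w' -> lik f n w = lik f n w'.
Proof. by move=> ww'; apply: eq_bigr => k kn; rewrite ww'. Qed.

Lemma agree_set_tnth n (i : 'I_N) w z : (n <= i)%N -> agree_below n (set_tnth i w z) w.
Proof.
move=> ni k kn; rewrite tnth_set_tnth ifF//; apply/negbTE.
by apply/eqP => ki; move: kn; rewrite ki ltnNge ni.
Qed.

Local Open Scope ereal_scope.

(** Covariates have the same law under all instances, so a functional that reads all covariates but
    only the first [n] rewards sees only the likelihood ratio of these [n] rounds. This is how the
    delayed feedback enters. *)
Lemma integral_bern_lik f (mf : measurable_fun [set: d.-tuple R] f) n (F : path -> R) :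
  (forall x, (`|f x| <= 2^-1)%R) -> mnn F ->
  (forall w w', agree_below n w w' -> agree_covariates w w' -> F w = F w') ->
  \int[iid_law (bern_law PX mf) N]_w (F w)%:E = \int[fair]_w (lik f n w * F w)%:E.
Proof.
move=> f12 hF Fblind.
(* Factors of the rounds from [n] on are removed one at a time, the last one first, by resampling
   that round. *)
have step j : \int[fair]_w (lik f (n + j) w * F w)%:E = \int[fair]_w (lik f n w * F w)%:E.
  elim: j => [|j <-]; first by rewrite addn0.
  have [jN|jN] := ltnP (n + j) N; last first.
    apply: eq_integral => w _; congr (_ * _)%:E; apply: eq_bigl => k.
    by rewrite !(leq_trans (ltn_ord k))// (leq_trans jN)// addnS.
  pose i := Ordinal jN.
  have hl m := mnn_lik m mf f12.
  rewrite (integral_iid_resample _ i); last 2 first.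
  - by apply: mnn_EFin; exact: mnnM.
  - by move=> w; rewrite lee_fin; exact: (mnnM (hl _) hF).2.
  rewrite [RHS](integral_iid_resample _ i); last 2 first.
  - by apply: mnn_EFin; exact: mnnM.
  - by move=> w; rewrite lee_fin; exact: (mnnM (hl _) hF).2.
  apply: eq_integral => w _.
  have likS z : lik f (n + j.+1) (set_tnth i w z) = (dens f z * lik f (n + j) (set_tnth i w z))%R.
    rewrite {1}/lik (bigD1 i)/=; last by rewrite addnS.
    rewrite tnth_set_tnth eqxx; congr (_ * _)%R; apply: eq_bigl => k.
    by rewrite addnS ltnS ltn_neqAle -val_eqE/= andbC.
  under eq_integral do rewrite likS -mulrA EFinM.
  have mset : measurable_fun setT (fun z => lik f (n + j) (set_tnth i w z) * F (set_tnth i w z))%R.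
    apply: (@measurableT_comp _ _ _ _ _ _ (fun w => lik f (n + j) w * F w)%R).
      exact: (mnnM (hl _) hF).1.
    exact: (measurable_fun_pair2 w (measurable_set_tnth i)).
  rewrite (integral_fair_dens PX mf)//.
  - exact/measurable_EFinP.
  - by move=> z; rewrite lee_fin; exact: (mnnM (hl _) hF).2.
  (* Flipping the reward of round [i = n + j] changes neither the earlier factors nor [F], which
     reads only the covariate of that round. *)
  - move=> x; congr EFin; congr (_ * _)%R.
      apply: lik_agree => k kn; rewrite !tnth_set_tnth.
      by case: eqP => // ki; move: kn; rewrite ki ltnn.
    apply: Fblind => k; rewrite !tnth_set_tnth; case: eqP => // ki.
    by rewrite ki /= ltnNge leq_addr.
rewrite (integral_iid_density (P := fair_law PX) (mnn_dens mf f12)); last 3 first.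
- by move=> h mh h0; exact: integral_bern_fair.
- exact: mnn_EFin.
- by move=> w; rewrite lee_fin; exact: hF.2.
rewrite -(step N); apply: eq_integral => w _; rewrite -EFinM; congr (_ * _)%:E.
by apply: eq_bigl => k; rewrite (leq_trans (ltn_ord k))// leq_addl.
Qed.

(** Independence of the covariate of round [i] from everything that ignores this round. *)
Lemma integral_fresh_covariate (i : 'I_N) (u : d.-tuple R -> R) (e : R) (G : path -> R) :
  mnn u -> \int[PX]_x (u x)%:E = e%:E -> mnn G ->
  (forall w z, G (set_tnth i w z) = G w) ->
  \int[fair]_w (u (tnth w i).1 * G w)%:E = e%:E * \int[fair]_w (G w)%:E.
Proof.
move=> hu ue hG Gi.
have hui : mnn (fun w => u (tnth w i).1) by apply: (mnn_comp hu); exact: measurable_covariate.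
rewrite (integral_iid_resample _ i); last 2 first.
- by apply: mnn_EFin; exact: mnnM.
- by move=> w; rewrite lee_fin; exact: (mnnM hui hG).2.
have e0 : (0 <= e)%R by rewrite -lee_fin -ue; exact: mnn_integral_ge0.
rewrite -mnn_integralZ//; apply: eq_integral => w _.
under eq_integral do rewrite tnth_set_tnth eqxx Gi mulrC.
rewrite mnn_integralZ//; last 2 first.
- exact: hG.2.
- by apply: (mnn_comp hu).
by rewrite integral_fair_covariate// ue -EFinM mulrC.
Qed.

Lemma integral_fair_prod (v : datum R d -> R) (c : R) n : (n <= N)%N -> mnn v ->
  \int[fair_law PX]_z (v z)%:E = c%:E ->
  \int[fair]_w (\prod_(k < N | (k < n)%N) v (tnth w k))%:E = (c ^+ n)%:E.
Proof.
move=> nN hv vc.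
under eq_integral do rewrite big_mkcond.
have hu (k : 'I_N) : mnn (fun z => if (k < n)%N then v z else 1%R).
  by case: (k < n)%N => //; exact: mnn_cst.
rewrite (integral_iid_prod _ hu).
rewrite (eq_bigr (fun k : 'I_N => (if (k < n)%N then c else 1%R)%:E)); last first.
  move=> k _; case: ifP => _ //.
  by rewrite integral_cst// [X in _ * X]probability_setT mule1.
rewrite prodEFin -big_mkcond/= -(big_ord_widen N (fun=> c) nN).
by rewrite prodr_const card_ord.
Qed.

End likelihood.

(** * The two-point bound *)

Section two_point.
Variables (R : realType) (d : nat) (PX : probability (d.-tuple R) R) (N : nat).
Local Notation path := (N.-tuple (datum R d)).
Local Notation fair := (iid_law (fair_law PX) N).
Variables (f0 : d.-tuple R -> R) (n : nat) (i : 'I_N).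
Hypotheses (mf0 : measurable_fun [set: d.-tuple R] f0)
  (f0b : forall x, `|f0 x| <= 4^-1) (ni : (n <= i)%N).
Implicit Types w : path.

Lemma lik_fresh f w z : lik f n (set_tnth i w z) = lik f n w.
Proof. exact: lik_agree (agree_set_tnth _ _ ni). Qed.

Lemma quarter_half (f : d.-tuple R -> R) :
  (forall x, `|f x| <= 4^-1) -> forall x, `|f x| <= 2^-1.
Proof. by move=> fb x; apply: le_trans (fb x) _; lra. Qed.

Section one_bump.
Variables (psi u : d.-tuple R -> R) (e q : R).
Hypotheses (mpsi : measurable_fun [set: d.-tuple R] psi)
  (psib : forall x, `|psi x| <= 4^-1) (disj : forall x, f0 x * psi x = 0)
  (hu : mnn u).
Hypotheses (ue : (\int[PX]_x (u x)%:E = e%:E)%E)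
  (qE : (\int[PX]_x (4 * psi x ^+ 2)%:E = q%:E)%E).

(** The cross term [4 * f0 * psi] vanishes because the supports are disjoint. Hence the likelihood
    ratio between [f0 + psi] and [f0] is the one of [psi] alone. *)
Lemma dens_add z : dens (fun x => f0 x + psi x) z = dens f0 z * dens psi z.
Proof.
have s2 : sg z ^+ 2 = 1 by rewrite /sg; case: ifP => _; ring.
transitivity (1 + 2 * sg z * (f0 z.1 + psi z.1) + 4 * sg z ^+ 2 * (f0 z.1 * psi z.1)).
  by rewrite disj mulr0 addr0.
by rewrite /dens; ring.
Qed.

Lemma lik_add w : lik (fun x => f0 x + psi x) n w = lik f0 n w * lik psi n w.
Proof. by rewrite /lik -big_split/=; apply: eq_bigr => k _; exact: dens_add. Qed.

Let hf0 m : mnn (@lik R d N f0 m) := mnn_lik N m mf0 (quarter_half f0b).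
Let hpsi m : mnn (@lik R d N psi m) := mnn_lik N m mpsi (quarter_half psib).

Let mpsi' : mnn (fun x => 4 * psi x ^+ 2).
Proof. by apply: mnnM; [exact: mnn_cst|exact: mnn_sqr]. Qed.

Local Open Scope ereal_scope.

Lemma integral_dens1 (f : d.-tuple R -> R) : measurable_fun [set: d.-tuple R] f ->
  (forall x, `|f x| <= 2^-1)%R -> \int[fair_law PX]_z (dens f z)%:E = 1%:E.
Proof.
move=> mf f12; under eq_integral do rewrite -[(dens f _)%:E]mule1.
rewrite (integral_fair_dens _ mf f12 (F := cst 1%:E))//.
by rewrite integral_cst// mul1e [X in X = _]probability_setT.
Qed.

(** Second moment, under the gap [f0], of the one-round likelihood ratio: [q] is the chi-square
    distance created by [psi] in one round. *)
Lemma integral_dens_sqr :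
  \int[fair_law PX]_z (dens f0 z * dens psi z ^+ 2)%:E = (1 + q)%:E.
Proof.
have h : mnn (fun z => dens f0 z * dens psi z ^+ 2)%R.
  apply: mnnM; first exact: mnn_dens mf0 (quarter_half f0b).
  by apply: mnn_sqr; exact: (mnn_dens mpsi (quarter_half psib)).1.
rewrite integral_fair; last 2 first.
- exact: mnn_EFin.
- by move=> z; rewrite lee_fin; exact: h.2.
rewrite (eq_integral (fun x => (1 + 4 * psi x ^+ 2)%:E)); last first.
  move=> x _; rewrite -!EFinM -EFinD /dens !sg_obs/=; congr EFin.
  transitivity (1 + 4 * psi x ^+ 2 + 8 * (f0 x * psi x))%R; first by field.
  by rewrite disj mulr0 addr0.
rewrite mnn_integralD; [|exact: mnn_cst|exact: mpsi'].
by rewrite qE integral_cst// mul1e [X in X + _]probability_setT.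
Qed.

(** The variance of the likelihood ratio after [n] rounds is [(1 + q)^n - 1], second moments being
    multiplicative; the covariate of round [i] is independent of it and contributes the factor
    [e]. *)
Lemma integral_lik_dev :
  \int[fair]_w (u (tnth w i).1 * (lik f0 n w * (lik psi n w - 1) ^+ 2))%:E =
  (e * ((1 + q) ^+ n - 1))%:E.
Proof.
have nN : (n <= N)%N by exact: leq_trans ni (ltnW (ltn_ord i)).
have hui : mnn (fun w => u (tnth w i).1).
  by apply: (mnn_comp hu); exact: measurable_covariate.
have m1 : mnn (fun w => (lik psi n w - 1) ^+ 2)%R.
  apply: mnn_sqr; apply: measurable_funB; [exact: (hpsi n).1|exact: measurable_cst].
have I G : mnn G -> (forall w z, G (set_tnth i w z) = G w) ->
    \int[fair]_w (u (tnth w i).1 * G w)%:E = e%:E * \int[fair]_w (G w)%:E.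
  by move=> hG Gi; exact: integral_fresh_covariate.
have e1 : \int[fair]_w (u (tnth w i).1 * (lik f0 n w * lik psi n w))%:E = e%:E.
  rewrite I//; last 2 first.
  - exact: mnnM.
  - by move=> w z; rewrite !lik_fresh.
  rewrite (eq_integral (fun w => (lik (fun x => f0 x + psi x)%R n w)%:E)); last first.
    by move=> w _; rewrite lik_add.
  have b12 x : (`|f0 x + psi x| <= 2^-1)%R.
    by apply: le_trans (ler_normD _ _) _; have := f0b x; have := psib x; lra.
  have mD : measurable_fun setT (fun x => f0 x + psi x)%R by exact: measurable_funD.
  rewrite (integral_fair_prod nN (mnn_dens mD b12) (integral_dens1 mD b12)).
  by rewrite expr1n mule1.
have e2 : \int[fair]_w (u (tnth w i).1 * (lik f0 n w * lik psi n w ^+ 2))%:E =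
    (e * (1 + q) ^+ n)%:E.
  rewrite I//; last 2 first.
  - by apply: mnnM => //; apply: mnn_sqr; exact: (hpsi n).1.
  - by move=> w z; rewrite !lik_fresh.
  rewrite EFinM; congr (_ * _).
  have h : mnn (fun z => dens f0 z * dens psi z ^+ 2)%R.
    apply: mnnM; first exact: mnn_dens mf0 (quarter_half f0b).
    by apply: mnn_sqr; exact: (mnn_dens mpsi (quarter_half psib)).1.
  rewrite -(integral_fair_prod nN h integral_dens_sqr); apply: eq_integral => w _.
  by rewrite /lik -prodrXl -big_split.
have e0 : \int[fair]_w (u (tnth w i).1 * lik f0 n w)%:E = e%:E.
  rewrite I//; last by move=> w z; rewrite !lik_fresh.
  rewrite (integral_fair_prod nN (mnn_dens mf0 (quarter_half f0b))
    (integral_dens1 mf0 (quarter_half f0b))).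
  by rewrite expr1n mule1.
(* The square is expanded with the negative term moved to the other side, so that only integrals of
   nonnegative functions occur; finiteness of the unknown one follows from the equation. *)
have : \int[fair]_w (u (tnth w i).1 * (lik f0 n w * (lik psi n w - 1) ^+ 2))%:E
    + \int[fair]_w (2 * (u (tnth w i).1 * (lik f0 n w * lik psi n w)))%:E =
    \int[fair]_w (u (tnth w i).1 * (lik f0 n w * lik psi n w ^+ 2))%:E
    + \int[fair]_w (u (tnth w i).1 * lik f0 n w)%:E.
  rewrite -!mnn_integralD//.
  - by apply: eq_integral => w _; congr EFin; ring.
  - by do 2 apply: mnnM => //; apply: mnn_sqr; exact: (hpsi n).1.
  - exact: mnnM.
  - by do 2 apply: mnnM => //.
  - by apply: mnnM; [exact: mnn_cst|do 2 apply: mnnM => //].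
rewrite mnn_integralZ//; last by do 2 apply: mnnM => //.
rewrite e1 e2 e0.
case: (integral _ _ _) => [r| |] //=.
by move=> -[H]; congr EFin; move: H; lra.
Qed.

End one_bump.

(* With [u = x - 1] and [v = y - 1], [min x y >= 1 - |u| - |v|] and
   [9/8 |u| <= 1/4 + 2 u^2]. *)
Lemma min_lik_ge (x y : R) : (2 + x + y) / 8 <=
  Num.min x y + 2 * ((x - 1) ^+ 2 + (y - 1) ^+ 2).
Proof.
have := sqr_ge0 (x - 1 - 9 / 32); have := sqr_ge0 (x - 1 + 9 / 32).
have := sqr_ge0 (y - 1 - 9 / 32); have := sqr_ge0 (y - 1 + 9 / 32).
have := sqr_ge0 (x - 1); have := sqr_ge0 (y - 1).
rewrite !expr2.
by case: (leP x y) => xy ? ? ? ? ? ?; nra.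
Qed.

Variables (phi : d.-tuple R -> R) (e q : R).
Hypotheses (mphi : measurable_fun [set: d.-tuple R] phi)
  (phib : forall x, 0 <= phi x <= 4^-1) (disj : forall x, f0 x * phi x = 0).
Hypotheses (phie : (\int[PX]_x (phi x)%:E = e%:E)%E)
  (qE : (\int[PX]_x (4 * phi x ^+ 2)%:E = q%:E)%E).
Hypotheses (mD : measurable_fun [set: d.-tuple R] (fun x => f0 x + phi x))
  (mB : measurable_fun [set: d.-tuple R] (fun x => f0 x - phi x)).
Variables A a : path -> bool.
Hypotheses (mA : measurable_fun [set: path] A) (ma : measurable_fun [set: path] a).
Hypothesis Aagree : forall w w', agree_below n w w' -> A w = A w'.
Hypothesis aagree : forall w w', agree_below n w w' -> agree_covariates w w' ->
  A w -> a w = a w'.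
Local Open Scope ereal_scope.

(** On [A] the arm pulled is wrong for one of the two signs, so the two costs sum to at least the
    integral under [f0] of [phi] times the smaller likelihood ratio, to which [min_lik_ge] applies.
    The left side keeps the probability of [A] under the reference and under both signs: single
    spikes are compared with the reference, full sign patterns with each other. *)
Lemma two_point_bound :
  (e / 8)%:E * (2%:E * \int[iid_law (bern_law PX mf0) N]_w ((A w)%:R)%:E
    + \int[iid_law (bern_law PX mD) N]_w ((A w)%:R)%:E
    + \int[iid_law (bern_law PX mB) N]_w ((A w)%:R)%:E)
  <= \int[iid_law (bern_law PX mD) N]_w ((A w && ~~ a w)%:R * phi (tnth w i).1)%:E
   + \int[iid_law (bern_law PX mB) N]_w ((A w && a w)%:R * phi (tnth w i).1)%:E
   + (4 * e * ((1 + q) ^+ n - 1))%:E.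
Proof.
have hphi : mnn phi by split=> // x; have /andP[] := phib x.
have phib' x : (`|phi x| <= 4^-1)%R.
  by rewrite ger0_norm; [have /andP[] := phib x|exact: hphi.2].
have mN : measurable_fun [set: d.-tuple R] (fun x => - phi x)%R.
  exact: measurableT_comp.
have phiNb x : (`|- phi x| <= 4^-1)%R by rewrite normrN.
have disjN x : (f0 x * - phi x = 0)%R by rewrite mulrN disj oppr0.
have qEN : \int[PX]_x (4 * (- phi x) ^+ 2)%:E = q%:E.
  by under eq_integral do rewrite sqrrN.
have f012 := quarter_half f0b.
have bD x : (`|f0 x + phi x| <= 2^-1)%R.
  by apply: le_trans (ler_normD _ _) _; have := f0b x; have := phib' x; lra.
have bB x : (`|f0 x - phi x| <= 2^-1)%R.
  by apply: le_trans (ler_normB _ _) _; have := f0b x; have := phib' x; lra.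
have hA : mnn (fun w => (A w)%:R : R) by exact: mnn_bool.
have hl0 : mnn (@lik R d N f0 n) := mnn_lik N n mf0 f012.
have hlp : mnn (@lik R d N phi n) := mnn_lik N n mphi (quarter_half phib').
have hlm : mnn (@lik R d N (fun x => - phi x)%R n) := mnn_lik N n mN (quarter_half phiNb).
have hp : mnn (fun w => phi (tnth w i).1).
  by apply: (mnn_comp hphi); exact: measurable_covariate.
have hAn : mnn (fun w => (A w && ~~ a w)%:R * phi (tnth w i).1)%R.
  apply: mnnM hp; apply: mnn_bool; apply: measurable_and => //; exact: measurable_neg.
have hAa : mnn (fun w => (A w && a w)%:R * phi (tnth w i).1)%R.
  by apply: mnnM hp; apply: mnn_bool; exact: measurable_and.
have bl w w' : agree_below n w w' -> agree_covariates w w' ->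
    (A w = A w') * (A w && a w = A w' && a w') * (A w && ~~ a w = A w' && ~~ a w').
  move=> ww' cc'; rewrite -(Aagree ww').
  by case: (boolP (A w)) => //= Aw; rewrite (aagree ww' cc' Aw).
pose lp w := lik phi n w; pose lm w := lik (fun x => - phi x)%R n w.
pose dp w := ((lp w - 1) ^+ 2)%R; pose dm w := ((lm w - 1) ^+ 2)%R.
have hdp : mnn dp.
  by apply: mnn_sqr; apply: measurable_funB; [exact: hlp.1|exact: measurable_cst].
have hdm : mnn dm.
  by apply: mnn_sqr; apply: measurable_funB; [exact: hlm.1|exact: measurable_cst].
have I G : mnn G -> (forall w z, G (set_tnth i w z) = G w) ->
    \int[fair]_w (phi (tnth w i).1 * G w)%:E = e%:E * \int[fair]_w (G w)%:E.
  by move=> hG Gi; exact: integral_fresh_covariate.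
have Aset w z : A (set_tnth i w z) = A w by exact: Aagree (agree_set_tnth _ _ ni).
have e0 : (0 <= e)%R by rewrite -lee_fin -phie; exact: mnn_integral_ge0.
have lD w : lik (fun x => f0 x + phi x)%R n w = (lik f0 n w * lp w)%R.
  exact: lik_add.
have lB w : lik (fun x => f0 x - phi x)%R n w = (lik f0 n w * lm w)%R.
  exact: (lik_add (psi := fun x => - phi x)%R).
have E0 : \int[iid_law (bern_law PX mf0) N]_w ((A w)%:R)%:E =
    \int[fair]_w (lik f0 n w * (A w)%:R)%:E.
  by apply: integral_bern_lik => // w w' ww' cc'; rewrite !(bl _ _ ww' cc').
have E1 : \int[iid_law (bern_law PX mD) N]_w ((A w)%:R)%:E =
    \int[fair]_w (lik f0 n w * lp w * (A w)%:R)%:E.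
  under [RHS]eq_integral do rewrite -lD.
  by apply: integral_bern_lik => // w w' ww' cc'; rewrite !(bl _ _ ww' cc').
have E2 : \int[iid_law (bern_law PX mB) N]_w ((A w)%:R)%:E =
    \int[fair]_w (lik f0 n w * lm w * (A w)%:R)%:E.
  under [RHS]eq_integral do rewrite -lB.
  by apply: integral_bern_lik => // w w' ww' cc'; rewrite !(bl _ _ ww' cc').
have E3 : \int[iid_law (bern_law PX mD) N]_w ((A w && ~~ a w)%:R * phi (tnth w i).1)%:E =
    \int[fair]_w (lik f0 n w * lp w * ((A w && ~~ a w)%:R * phi (tnth w i).1))%:E.
  under [RHS]eq_integral do rewrite -lD.
  by apply: integral_bern_lik => // w w' ww' cc'; rewrite !(bl _ _ ww' cc') cc'.
have E4 : \int[iid_law (bern_law PX mB) N]_w ((A w && a w)%:R * phi (tnth w i).1)%:E =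
    \int[fair]_w (lik f0 n w * lm w * ((A w && a w)%:R * phi (tnth w i).1))%:E.
  under [RHS]eq_integral do rewrite -lB.
  by apply: integral_bern_lik => // w w' ww' cc'; rewrite !(bl _ _ ww' cc') cc'.
have D1 : \int[fair]_w (2 * (phi (tnth w i).1 * (lik f0 n w * dp w)))%:E =
    (2 * (e * ((1 + q) ^+ n - 1)))%:E.
  rewrite mnn_integralZ//; last by do 2 apply: mnnM => //.
  by rewrite (integral_lik_dev mphi phib' disj hphi phie qE).
have D2 : \int[fair]_w (2 * (phi (tnth w i).1 * (lik f0 n w * dm w)))%:E =
    (2 * (e * ((1 + q) ^+ n - 1)))%:E.
  rewrite mnn_integralZ//; last by do 2 apply: mnnM => //.
  by rewrite (integral_lik_dev mN phiNb disjN hphi phie qEN).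
have mlp : mnn (fun w => lik f0 n w * lp w * (A w)%:R)%R by do 2 apply: mnnM => //.
have mlm : mnn (fun w => lik f0 n w * lm w * (A w)%:R)%R by do 2 apply: mnnM => //.
have ml0 : mnn (fun w => lik f0 n w * (A w)%:R)%R by apply: mnnM.
have m20 : mnn (fun w => 2 * (lik f0 n w * (A w)%:R))%R.
  by apply: mnnM => //; exact: mnn_cst.
pose G w := (2 * (lik f0 n w * (A w)%:R) + lik f0 n w * lp w * (A w)%:R
  + lik f0 n w * lm w * (A w)%:R)%R.
have hG : mnn G by do 2 apply: mnnD => //.
have -> : (4 * e * ((1 + q) ^+ n - 1))%:E = \int[fair]_w
    (2 * (phi (tnth w i).1 * (lik f0 n w * dp w)))%:E +
    \int[fair]_w (2 * (phi (tnth w i).1 * (lik f0 n w * dm w)))%:E.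
  by rewrite D1 D2 -EFinD; congr EFin; ring.
have m2p : mnn (fun w => 2 * (phi (tnth w i).1 * (lik f0 n w * dp w)))%R.
  by apply: mnnM; [exact: mnn_cst|do 2 apply: mnnM => //].
have m2m : mnn (fun w => 2 * (phi (tnth w i).1 * (lik f0 n w * dm w)))%R.
  by apply: mnnM; [exact: mnn_cst|do 2 apply: mnnM => //].
have mR1 : mnn (fun w => lik f0 n w * lp w * ((A w && ~~ a w)%:R * phi (tnth w i).1))%R.
  by apply: mnnM => //; apply: mnnM.
have mR2 : mnn (fun w => lik f0 n w * lm w * ((A w && a w)%:R * phi (tnth w i).1))%R.
  by apply: mnnM => //; apply: mnnM.
rewrite E0 E1 E2 E3 E4 -mnn_integralZ// -!mnn_integralD//; last 3 first.
- exact: mnnD.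
- exact: mnnD.
- exact: mnnD.
(* [A] and the likelihoods ignore round [i], so [e] is turned back into an integral of [phi] and
   both sides become integrals over the same space, comparable pointwise. *)
rewrite EFinM [X in X * _]muleC -muleA -I//; last first.
  by move=> w z; rewrite /G /lp /lm !lik_fresh// Aset.
rewrite -mnn_integralZ ?invr_ge0//; last exact: mnnM.
apply: mnn_integral_le.
- by apply: mnnM; [apply: mnn_cst; rewrite invr_ge0|exact: mnnM].
- by apply: mnnD; apply: mnnD.
move=> w; rewrite /G; set ph := phi _.
have ph0 : (0 <= ph)%R by exact: hphi.2.
have l0 := hl0.2 w.
case: (boolP (A w)) => /= Aw; last first.
  rewrite !mulr0 !mul0r !addr0 !mulr0 !add0r; apply: addr_ge0.
    by rewrite mulr_ge0// mulr_ge0// mulr_ge0//; exact: hdp.2.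
  by rewrite mulr_ge0// mulr_ge0// mulr_ge0//; exact: hdm.2.
have pl0 : (0 <= ph * lik f0 n w)%R by exact: mulr_ge0.
have := ler_wpM2l pl0 (min_lik_ge (lp w) (lm w)).
rewrite -/(dp w) -/(dm w) => H.
(* Whichever arm [a w] is, the cost on the right carries [lp w] or [lm w], both at least the
   minimum. *)
have /(ler_wpM2l pl0) : (Num.min (lp w) (lm w) <= lp w)%R by rewrite ge_min lexx.
have /(ler_wpM2l pl0) : (Num.min (lp w) (lm w) <= lm w)%R by rewrite ge_min lexx orbT.
move: (Num.min _ _) H => m.
by case: (a w) => /=; lra.
Qed.

End two_point.

(** * Spikes on small cubes *)

Lemma probability_bool {dT : measure_display} {T : measurableType dT} {R : realType}
    (P : probability T R) (b : T -> bool) : measurable_fun [set: T] b ->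
  (P [set x | b x] = \int[P]_x ((b x)%:R)%:E)%E.
Proof.
move=> mb; have mB : measurable [set x | b x].
  by rewrite -[X in measurable X]setTI; exact: (mb measurableT [set true]).
rewrite -[LHS]mul1e -(setIT [set x | b x]) -integral_indic// mul1e.
by apply: eq_integral => x _; rewrite indicE mem_setE.
Qed.

(** * Elementary inequalities for powers *)

Section powR_facts.
Variable R : realType.
Implicit Types a b s t : R.

(** From [t <= t^r] for [t] in [(0, 1]], applied to the shares [a / (a + b)] and [b / (a + b)],
    which sum to one. *)
Lemma powR_subadditive a b r : 0 <= a -> 0 <= b -> 0 < r <= 1 ->
  (a + b) `^ r <= a `^ r + b `^ r.
Proof.
move=> a0 b0 /andP[r0 r1].
have [->|an0] := eqVneq a 0; first by rewrite add0r lerDr powR_ge0.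
have [->|bn0] := eqVneq b 0; first by rewrite addr0 lerDl powR_ge0.
have ap : 0 < a by rewrite lt_neqAle eq_sym an0.
have bp : 0 < b by rewrite lt_neqAle eq_sym bn0.
have sp : 0 < a + b by exact: addr_gt0.
have ge c : 0 < c -> c <= a + b -> (a + b) `^ r * (c / (a + b)) <= c `^ r.
  move=> cp cs; have cr : 0 < c / (a + b) <= 1.
    by rewrite divr_gt0//= ler_pdivrMr// mul1r.
  apply: (@le_trans _ _ ((a + b) `^ r * (c / (a + b)) `^ r)).
    by rewrite ler_wpM2l ?powR_ge0// ger1_powR.
  rewrite -powRM//; [|exact: ltW|by case/andP: cr => /ltW].
  by rewrite mulrCA divff ?mulr1// gt_eqF.
have -> : (a + b) `^ r = (a + b) `^ r * (a / (a + b)) + (a + b) `^ r * (b / (a + b)).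
  by rewrite -mulrDr -mulrDl divff ?mulr1// gt_eqF.
by apply: lerD; apply: ge => //; lra.
Qed.

Lemma powR_holder a b t r : 0 <= a -> 0 <= b -> 0 < r <= 1 -> `|a - b| <= t ->
  `|a `^ r - b `^ r| <= t `^ r.
Proof.
have main c e : 0 <= c -> 0 <= e -> 0 < r <= 1 -> `|c - e| <= t -> e <= c ->
    `|c `^ r - e `^ r| <= t `^ r.
  move=> c0 e0 r01 cet ec; have r0 : 0 <= r by case/andP: r01 => /ltW.
  have t0 : 0 <= t by exact: le_trans (normr_ge0 _) cet.
  rewrite ger0_norm ?subr_ge0; last by apply: ge0_ler_powR; rewrite ?nnegrE.
  rewrite lerBlDr; apply: (@le_trans _ _ ((t + e) `^ r)); last exact: powR_subadditive.
  apply: ge0_ler_powR; rewrite ?nnegrE//; first exact: addr_ge0.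
  by rewrite -lerBlDr; apply: le_trans (ler_norm _) cet.
move=> a0 b0 r01 abt; case: (leP b a) => ba; first exact: main.
by rewrite distrC; apply: main => //; [rewrite distrC|exact: ltW].
Qed.

(** Mean value bound, meant for the volume of the boundary layer of a cube. *)
Lemma ler_exprB a b n : 0 <= b -> b <= a ->
  a ^+ n.+1 - b ^+ n.+1 <= n.+1%:R * (a - b) * a ^+ n.
Proof.
move=> b0 ba; elim: n => [|n IH]; first by rewrite !expr1 expr0; lra.
have a0 : 0 <= a by exact: le_trans ba.
have ab : 0 <= a - b by rewrite subr_ge0.
rewrite (_ : _ - _ = a * (a ^+ n.+1 - b ^+ n.+1) + (a - b) * b ^+ n.+1); last first.
  by rewrite [a ^+ n.+2]exprS [b ^+ n.+2]exprS; ring.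
rewrite [leRHS](_ : _ = a * (n.+1%:R * (a - b) * a ^+ n) + (a - b) * a ^+ n.+1); last first.
  by rewrite -[n.+2%:R]natr1 exprS; ring.
by apply: lerD; [exact: ler_wpM2l|apply: ler_wpM2l => //; exact: lerXn2r].
Qed.

End powR_facts.

Section spike.
Variables (R : realType) (d : nat).
Implicit Types (lo : 'I_d -> R) (x y : d.-tuple R).
Local Notation PX := (uniform_cube R d).

Definition shrunk_box lo h t x :=
  [forall i, (lo i + t < tnth x i) && (tnth x i < lo i + h - t)].

(** Sup-norm distance to the boundary of the cube, counted negatively outside. The initial value
    [h / 2] does not alter the minimum when [d > 0], since no point is farther than that from the
    nearer of two opposite faces. *)
Definition depth lo h x : R :=
  \big[Num.min/h / 2]_(i < d) Num.min (tnth x i - lo i) (lo i + h - tnth x i).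

Lemma depth_gt lo h t x : (t < depth lo h x) = (t < h / 2) && shrunk_box lo h t x.
Proof.
apply/bigmin_gtP/andP => [[th H]|[th /forallP H]]; split => //.
  by apply/forallP => i; have := H i isT; rewrite lt_min; lra.
by move=> i _; have := H i; rewrite lt_min; lra.
Qed.

Lemma coord_dist2 x y i : `|tnth x i - tnth y i| <= dist2 x y.
Proof.
rewrite -sqrtr_sqr /dist2 ler_sqrt; last by apply: sumr_ge0 => j _; exact: sqr_ge0.
by rewrite (bigD1 i)//= lerDl sumr_ge0// => j _; exact: sqr_ge0.
Qed.

Lemma depth_lipschitz lo h x y : `|depth lo h x - depth lo h y| <= dist2 x y.
Proof.
have main u v : dist2 u v = dist2 x y -> depth lo h u - dist2 x y <= depth lo h v.
  move=> uv; apply/bigmin_geP; split => [|i _].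
    have := @bigmin_le_id _ _ 'I_d (index_enum _) (h / 2) xpredT
      (fun i => Num.min (tnth u i - lo i) (lo i + h - tnth u i)).
    rewrite -/(depth lo h u); have : 0 <= dist2 x y by exact: sqrtr_ge0.
    lra.
  have := bigmin_le (h / 2) i (fun i => Num.min (tnth u i - lo i) (lo i + h - tnth u i)).
  rewrite -/(depth lo h u) !le_min => /andP[].
  have := coord_dist2 u v i; rewrite uv ler_norml; lra.
have dC : dist2 y x = dist2 x y.
  by rewrite /dist2; congr Num.sqrt; apply: eq_bigr => i _; rewrite -sqrrN opprB.
have := main x y erefl; have := main y x dC; rewrite ler_norml; lra.
Qed.

Lemma measurable_depth lo h : measurable_fun [set: d.-tuple R] (depth lo h).
Proof.
rewrite /depth; elim: (index_enum _) => [|i s IH].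
  rewrite (_ : (fun _ => _) = fun=> h / 2)//.
  by apply/funext => x; rewrite big_nil.
rewrite (_ : (fun _ => _) = fun x => Num.min (Num.min (tnth x i - lo i) (lo i + h - tnth x i))
  (\big[Num.min/h / 2]_(j <- s) Num.min (tnth x j - lo j) (lo j + h - tnth x j))).
  apply: measurable_minr => //; apply: measurable_minr.
    by apply: measurable_funB => //; exact: measurable_tnth.
  by apply: measurable_funB => //; exact: measurable_tnth.
by apply/funext => x; rewrite big_cons.
Qed.

Lemma shrunk_box_prod lo h t x : (shrunk_box lo h t x)%:R =
  \prod_(i < d) ((lo i + t < tnth x i) && (tnth x i < lo i + h - t))%:R :> R.
Proof.
rewrite /shrunk_box; case: forallP => [H|/forallP].
  by rewrite big1// => i _; rewrite H.
by rewrite negb_forall => /existsP[i /negbTE iF]; rewrite (bigD1 i)//= iF mul0r.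
Qed.

Lemma mnn_coord (a b : R) : mnn (fun u : R => ((a < u) && (u < b))%:R : R).
Proof. by apply: mnn_bool; apply: measurable_and; exact: measurable_fun_ltr. Qed.

Lemma mnn_shrunk_box lo h t : mnn (fun x => (shrunk_box lo h t x)%:R : R).
Proof.
rewrite (_ : (fun _ => _) = fun x => \prod_(i < d)
    ((lo i + t < tnth x i) && (tnth x i < lo i + h - t))%:R).
  apply: mnn_prod => i _; apply: (mnn_comp (mnn_coord _ _)).
  exact: measurable_tnth.
by apply/funext => x; rewrite shrunk_box_prod.
Qed.

Lemma integral_shrunk_box lo h t : 0 <= t -> 2 * t <= h ->
  (forall i, 0 <= lo i) -> (forall i, lo i + h <= 1) ->
  (\int[PX]_x ((shrunk_box lo h t x)%:R)%:E = ((h - 2 * t) ^+ d)%:E)%E.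
Proof.
move=> t0 th lo0 lo1.
under eq_integral do rewrite shrunk_box_prod.
rewrite (integral_iid_prod (@unif01 R)
  (u := fun i u => ((lo i + t < u) && (u < lo i + h - t))%:R)); last first.
  by move=> i; exact: mnn_coord.
rewrite (eq_bigr (fun=> (h - 2 * t)%:E)).
  by rewrite prodEFin prodr_const card_ord.
move=> i _; have mc : measurable_fun setT (fun u : R => (lo i + t < u) && (u < lo i + h - t)).
  by apply: measurable_and; exact: measurable_fun_ltr.
transitivity (unif01 [set u | lo i + t < u < lo i + h - t]).
  exact/esym/(probability_bool (@unif01 R) mc).
rewrite unif01_oo.
- by congr EFin; ring.
- by have := lo0 i; lra.
- by have := lo1 i; lra.
- lra.
Qed.

Variables (lo : 'I_d -> R) (h kappa beta : R).
Hypotheses (h0 : 0 < h) (k0 : 0 < kappa) (b01 : 0 < beta <= 1).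
Hypotheses (lo0 : forall i, 0 <= lo i) (lo1 : forall i, lo i + h <= 1).

(** The depth is 1-Lipschitz for the Euclidean distance too, so its power [beta] is Hölder with
    constant one. The truncation at zero is essential outside the cube, where the power of a
    negative number would not vanish. *)
Definition spike x : R := kappa * (Num.max 0 (depth lo h x)) `^ beta.

Lemma spike_ge0 x : 0 <= spike x.
Proof. by rewrite mulr_ge0 ?powR_ge0// ltW. Qed.

Let beta0 : 0 < beta. Proof. by case/andP: b01. Qed.

Lemma spike_gt0 x : (0 < spike x) = shrunk_box lo h 0 x.
Proof.
rewrite /spike pmulr_rgt0//.
have := depth_gt lo h 0 x; rewrite divr_gt0//= => <-.
have [d0|d0] := ltP 0 (depth lo h x).
  by rewrite powR_gt0.
by rewrite powR0 ?ltxx// gt_eqF.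
Qed.

Lemma spike0 x : ~~ shrunk_box lo h 0 x -> spike x = 0.
Proof.
by rewrite -spike_gt0 -leNgt => b; apply/le_anti; rewrite b spike_ge0.
Qed.

Lemma depth_le_half x : depth lo h x <= h / 2.
Proof. by rewrite leNgt depth_gt ltxx. Qed.

Lemma spike_le x : spike x <= kappa * (h / 2) `^ beta.
Proof.
rewrite /spike ler_pM2l//; apply: ge0_ler_powR; rewrite ?nnegrE ?le_max ?lexx//.
- exact: ltW.
- by rewrite divr_ge0// ltW.
- by rewrite ge_max divr_ge0 ?depth_le_half// ltW.
Qed.

Lemma measurable_spike : measurable_fun [set: d.-tuple R] spike.
Proof.
apply: measurable_funM => //.
apply: (measurableT_comp (measurable_powR beta)).
by apply: measurable_maxr => //; exact: measurable_depth.
Qed.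

Lemma mnn_spike : mnn spike.
Proof. by split; [exact: measurable_spike|exact: spike_ge0]. Qed.

Lemma spike_holder x y : `|spike x - spike y| <= kappa * dist2 x y `^ beta.
Proof.
rewrite /spike -mulrBr normrM (gtr0_norm k0) ler_pM2l//.
apply: powR_holder => //; rewrite ?le_max ?lexx//.
have := depth_lipschitz lo h x y; rewrite !ler_norml.
have : 0 <= dist2 x y by exact: sqrtr_ge0.
by case: (leP 0 (depth lo h x)); case: (leP 0 (depth lo h y)); lra.
Qed.

(** On the concentric cube of side [h / 2] the depth is at least [h / 4]. *)
Lemma integral_spike_ge : exists2 e : R, (\int[PX]_x (spike x)%:E = e%:E)%E &
  kappa * (h / 4) `^ beta * (h / 2) ^+ d <= e.
Proof.
have hb := mnn_spike.
have fin : (\int[PX]_x (spike x)%:E <= (kappa * (h / 2) `^ beta)%:E)%E.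
  apply: (@le_trans _ _ (\int[PX]_x (kappa * (h / 2) `^ beta)%:E)%E).
    apply: mnn_integral_le => //; last exact: spike_le.
    by apply: mnn_cst; rewrite mulr_ge0 ?powR_ge0// ltW.
  by rewrite integral_cst// [X in (_ * X)%E]probability_setT mule1.
have fn : (\int[PX]_x (spike x)%:E)%E \is a fin_num.
  by rewrite ge0_fin_numE ?(le_lt_trans fin) ?ltry//; exact: mnn_integral_ge0.
exists (fine (\int[PX]_x (spike x)%:E)%E); first by rewrite fineK.
rewrite -lee_fin fineK// EFinM.
have -> : h / 2 = h - 2 * (h / 4) by field.
rewrite -(integral_shrunk_box (lo := lo)) //; [|by have := h0; lra|by have := h0; lra].
have c0 : 0 <= kappa * (h / 4) `^ beta by rewrite mulr_ge0 ?powR_ge0// ltW.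
rewrite -mnn_integralZ//; last exact: mnn_shrunk_box.
apply: mnn_integral_le => //; first by apply: mnnM; [exact: mnn_cst|exact: mnn_shrunk_box].
move=> x; have [bx|] := boolP (shrunk_box lo h (h / 4) x); last first.
  by rewrite mulr0 => _; exact: spike_ge0.
rewrite mulr1 ler_pM2l//; apply: ge0_ler_powR; rewrite ?nnegrE ?le_max ?lexx//.
- exact: ltW.
- by rewrite divr_ge0// ltW.
- by apply/orP; right; apply: ltW; rewrite depth_gt bx andbT; have := h0; lra.
Qed.

Lemma integral_spike_sqr : exists2 q : R, (\int[PX]_x (4 * spike x ^+ 2)%:E = q%:E)%E &
  0 <= q <= 4 * (kappa * (h / 2) `^ beta) ^+ 2 * h ^+ d.
Proof.
have hb := mnn_spike.
have hb2 : mnn (fun x => 4 * spike x ^+ 2).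
  by apply: mnnM; [exact: mnn_cst|exact: (mnn_sqr hb.1)].
set c := 4 * _.
have c0 : 0 <= c by rewrite mulr_ge0// sqr_ge0.
have fin : (\int[PX]_x (4 * spike x ^+ 2)%:E <= (c * h ^+ d)%:E)%E.
  have box : (\int[PX]_x ((shrunk_box lo h 0 x)%:R)%:E = (h ^+ d)%:E)%E.
    by rewrite integral_shrunk_box ?mulr0 ?subr0// ltW.
  rewrite EFinM -box.
  rewrite -mnn_integralZ//; last exact: mnn_shrunk_box.
  apply: mnn_integral_le => //; first by apply: mnnM; [exact: mnn_cst|exact: mnn_shrunk_box].
  move=> x; have [bx|/spike0 ->] := boolP (shrunk_box lo h 0 x); last by rewrite expr0n !mulr0.
  rewrite mulr1 /c ler_pM2l// ler_sqr ?nnegrE ?spike_ge0//; first exact: spike_le.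
  by rewrite mulr_ge0 ?powR_ge0// ltW.
have fn : (\int[PX]_x (4 * spike x ^+ 2)%:E)%E \is a fin_num.
  by rewrite ge0_fin_numE ?(le_lt_trans fin) ?ltry//; exact: mnn_integral_ge0.
exists (fine (\int[PX]_x (4 * spike x ^+ 2)%:E)%E); first by rewrite fineK.
by rewrite fine_ge0 ?mnn_integral_ge0//= -lee_fin fineK.
Qed.

(** Positive values up to [delta] occur only in a layer along the boundary of the cube, of volume at
    most [2 d t h^(d - 1)] where [t] is its thickness. Interpolating between [t] and [h] yields the
    powers [delta^alpha] and [h^(d - alpha beta)]. *)
Lemma integral_spike_margin alpha delta : (0 < d)%N -> 0 < alpha ->
  alpha * beta <= 1 -> 0 <= delta ->
  (\int[PX]_x (((0 < spike x) && (spike x <= delta))%:R)%:E <=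
   (2 * d%:R * kappa^-1 `^ alpha * h `^ (d%:R - alpha * beta) * delta `^ alpha)%:E)%E.
Proof.
move=> d0 a0 ab1 de0.
have h_ge0 : 0 <= h by exact: ltW.
have hn0 : h != 0 by rewrite gt_eqF.
set th := alpha * beta.
have th0 : 0 < th by exact: mulr_gt0.
(* The depth at which the spike reaches the height [delta]. *)
pose t := (kappa^-1 * delta) `^ beta^-1.
have kd0 : 0 <= kappa^-1 * delta by rewrite mulr_ge0 ?invr_ge0// ltW.
have t0 : 0 <= t by exact: powR_ge0.
have tth : t `^ th = kappa^-1 `^ alpha * delta `^ alpha.
  rewrite -powRM ?invr_ge0//; last exact: ltW.
  rewrite /t -powRrM; congr (_ `^ _).
  by rewrite /th mulrCA mulVf ?mulr1// gt_eqF.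
have hd : h ^+ d = h `^ (d%:R - th) * h `^ th.
  by rewrite -powRD ?subrK ?powR_mulrn// hn0 implybT.
have box : (\int[PX]_x ((shrunk_box lo h 0 x)%:R)%:E = (h ^+ d)%:E)%E.
  by rewrite integral_shrunk_box ?mulr0 ?subr0// ltW.
have mI : mnn (fun x => ((0 < spike x) && (spike x <= delta))%:R : R).
  apply: mnn_bool; apply: measurable_and.
    by apply: measurable_fun_ltr => //; exact: measurable_spike.
  by apply: measurable_fun_ler => //; exact: measurable_spike.
have d1 : 1 <= d%:R :> R by rewrite ler1n.
have -> : 2 * d%:R * kappa^-1 `^ alpha * h `^ (d%:R - th) * delta `^ alpha =
    2 * d%:R * h `^ (d%:R - th) * t `^ th by rewrite tth; ring.
(* If the layer fills the cube, its volume is bounded by [h^d], and [h^th <= (2 t)^th <= 2 t^th]. *)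
have [ht|th2] := leP (h / 2) t.
  apply: (@le_trans _ _ (h ^+ d)%:E).
    rewrite -box; apply: mnn_integral_le => //; first exact: mnn_shrunk_box.
    by move=> x; rewrite spike_gt0; case: (shrunk_box _ _ _ _); rewrite //= lern1 leq_b1.
  rewrite lee_fin hd -mulrA [in leRHS]mulrCA ler_wpM2l ?powR_ge0//.
  apply: (@le_trans _ _ ((2 * t) `^ th)).
    apply: ge0_ler_powR; [exact: ltW|by rewrite nnegrE|by rewrite nnegrE mulr_ge0|].
    by move: ht; lra.
  rewrite powRM// ler_wpM2r ?powR_ge0//.
  apply: (@le_trans _ _ 2); first by apply: ler1_powR => //; lra.
  lra.
(* The volume of the layer is linear in [t]; as [alpha * beta <= 1], the excess power [t^(1 - th)]
   can be traded for [h^(1 - th)]. *)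
have tE : t = t `^ th * t `^ (1 - th).
  by rewrite -powRD ?subrKC ?powRr1// oner_eq0.
have th1 : t `^ (1 - th) <= h `^ (1 - th).
  by apply: ge0_ler_powR; rewrite ?nnegrE ?subr_ge0//; move: th2; lra.
have hh : h `^ (1 - th) * h ^+ d.-1 = h `^ (d%:R - th).
  rewrite -powR_mulrn// -powRD ?hn0 ?implybT//; congr (_ `^ _).
  by rewrite -[in RHS](prednK d0) -natr1; ring.
(* The layer and the inner cube are disjoint parts of the cube: deeper than [t], the spike exceeds
   [delta]. *)
have sub : (\int[PX]_x (((0 < spike x) && (spike x <= delta))%:R)%:E +
    ((h - 2 * t) ^+ d)%:E <= (h ^+ d)%:E)%E.
  rewrite -box -(integral_shrunk_box (lo := lo))//; last by move: th2; lra.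
  rewrite -mnn_integralD//; last exact: mnn_shrunk_box.
  apply: mnn_integral_le.
  - by apply: mnnD => //; exact: mnn_shrunk_box.
  - exact: mnn_shrunk_box.
  move=> x; rewrite spike_gt0.
  have := depth_gt lo h t x; rewrite th2/= => dt.
  have [bt|bt] := boolP (shrunk_box lo h t x); last first.
    by rewrite addr0; case: (shrunk_box _ _ _ _); rewrite //= lern1 leq_b1.
  have td : t < depth lo h x by rewrite dt.
  have db : shrunk_box lo h 0 x.
    have := depth_gt lo h 0 x; rewrite (le_lt_trans t0 td).
    by move=> /esym/andP[].
  rewrite db /= [_ <= delta](_ : _ = false) ?add0r//; apply/negbTE; rewrite -ltNge.
  rewrite /spike max_r; last exact: ltW (le_lt_trans t0 td).
  rewrite -ltr_pdivrMl//; apply: (@le_lt_trans _ _ (t `^ beta)).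
    by rewrite /t -powRrM mulVf ?gt_eqF// powRr1.
  by apply: gt0_ltr_powR; rewrite ?nnegrE//; exact: ltW (le_lt_trans t0 td).
have {}sub : (\int[PX]_x (((0 < spike x) && (spike x <= delta))%:R)%:E <=
    (h ^+ d - (h - 2 * t) ^+ d)%:E)%E.
  by rewrite EFinB leeBrDr.
apply: le_trans sub _; rewrite lee_fin.
have := @ler_exprB R h (h - 2 * t) d.-1; rewrite prednK// => B.
apply: le_trans (B _ _) _; [by move: th2; lra|by lra|].
rewrite (_ : h - (h - 2 * t) = 2 * t); last by ring.
rewrite {1}tE -hh.
rewrite [leLHS](_ : _ = 2 * d%:R * (t `^ th * h ^+ d.-1) * t `^ (1 - th)); last by ring.
rewrite [leRHS](_ : _ = 2 * d%:R * (t `^ th * h ^+ d.-1) * h `^ (1 - th)); last by ring.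
by apply: ler_wpM2l => //; rewrite !mulr_ge0 ?powR_ge0 ?exprn_ge0.
Qed.

End spike.

(** * Information available to a batched policy *)

Section policy.
Variables (R : realType) (d T M : nat).
Variables (dS : measure_display) (S : measurableType dS).
Variable p : batch_policy R d T S M.
Local Notation path := (T.-tuple (datum R d)).
Implicit Types (s : S) (w : path).

Lemma grid_le s w l j : (l <= j)%N -> (j <= M)%N -> (grid p l s w <= grid p j s w)%N.
Proof.
elim: j => [|j IH]; first by rewrite leqn0 => /eqP ->.
rewrite leq_eqVlt => /orP[/eqP -> //|lj] jM.
by apply: leq_trans (IH lj (ltnW jM)) (ltnW (grid_increasing p s w jM)).
Qed.

(** Grid points and rules have to be handled in one induction over the batches: the next grid point
    depends on observed rewards, these on the arms pulled, and these on the rules of earlier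
    batches. The bound on the grid is assumed for [w] only, since the grid of [w'] follows it. *)
Lemma grid_rule_agree s n j w w' : agree_below n w w' -> (j < M)%N ->
  (grid p j s w <= n)%N -> forall l, (l <= j)%N ->
  grid p l s w = grid p l s w' /\
  forall i : 'I_T, (i < grid p l s w)%N -> rule p i s w = rule p i s w'.
Proof.
move=> ww' jM jn; elim=> [_|l IH lj].
  by rewrite !grid_first.
have [gl rl] := IH (ltnW lj).
have lM : (l < M)%N by exact: ltn_trans jM.
have ln : (grid p l s w <= n)%N.
  exact: leq_trans (grid_le s w (ltnW lj) (ltnW jM)) jn.
have l1n : (grid p l.+1 s w <= n)%N by exact: leq_trans (grid_le s w lj (ltnW jM)) jn.
have sc m : (m <= n)%N -> same_covariates m w w'.
  by move=> mn i im; rewrite /covariate ww'// (leq_trans im).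
have sr : same_rewards (rule p) (grid p l s w) s w w'.
  move=> i il; rewrite /observed_reward /action /covariate rl// ww'//.
  exact: leq_trans il ln.
split=> [|i il1].
  (* The first grid point is fixed before the game; adaptedness speaks only of the later ones. *)
  case: l {IH lj gl rl} lM ln l1n sr => [|l] lM ln l1n sr; first exact: grid_one_fixed.
  by apply: grid_adapted => //; exact: sc.
have [/rl //|li] := ltnP i (grid p l s w).
apply: (rule_adapted (j := l)) => //; first by rewrite li.
by apply: sc; exact: leq_trans il1 l1n.
Qed.

(** Rounds are indexed from zero, so the strict inequality puts every index from [tau j] through
    [tau j.+1] into the same batch. *)
Definition batch_event (tau : nat -> nat) s (j : nat) w : bool :=
  (grid p j s w <= tau j)%N && (tau j.+1 < grid p j.+1 s w)%N.

Variable tau : nat -> nat.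

(** The end of the batch may lie far beyond [tau j], but it is already determined when the batch
    starts. *)
Lemma grid_next_agree s j w w' : (j < M)%N -> agree_below (tau j) w w' ->
  (grid p j s w <= tau j)%N ->
  grid p j s w = grid p j s w' /\ grid p j.+1 s w = grid p j.+1 s w'.
Proof.
move=> jM ww' jn; have [gj rj] := grid_rule_agree ww' jM jn (leqnn j).
split => //; case: j jM ww' jn gj rj => [|j] jM ww' jn gj rj; first exact: grid_one_fixed.
apply: grid_adapted => // i ij; first by rewrite /covariate ww'// (leq_trans ij).
by rewrite /observed_reward /action /covariate rj// ww'// (leq_trans ij).
Qed.

(** Agreement can only be propagated from a table whose grid point [j] is at most [tau j]; hence
    both tables are tried, and if neither qualifies the event fails for both. *)
Lemma batch_event_agree s j w w' : (j < M)%N -> agree_below (tau j) w w' ->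
  batch_event tau s j w = batch_event tau s j w'.
Proof.
move=> jM ww'; have w'w : agree_below (tau j) w' w by move=> k kn; rewrite ww'.
have [jn|jn] := leqP (grid p j s w) (tau j).
  by have [g1 g2] := grid_next_agree jM ww' jn; rewrite /batch_event g1 g2.
have [jn'|jn'] := leqP (grid p j s w') (tau j).
  by have [g1 g2] := grid_next_agree jM w'w jn'; rewrite /batch_event g1 g2.
by rewrite /batch_event (leqNgt (grid p j s w)) jn (leqNgt (grid p j s w')) jn'.
Qed.

Lemma batch_action_agree s j w w' (i : 'I_T) : (j < M)%N ->
  agree_below (tau j) w w' -> agree_covariates w w' ->
  (tau j <= i <= tau j.+1)%N -> batch_event tau s j w ->
  action (rule p) s w i = action (rule p) s w' i.
Proof.
move=> jM ww' cc' /andP[ni iN] /andP[gn ng].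
have [gj rj] := grid_rule_agree ww' jM gn (leqnn j).
rewrite /action /covariate cc'; congr (_ _).
apply: (rule_adapted (j := j)) => //.
- by rewrite (leq_trans gn ni) (leq_ltn_trans iN ng).
- by move=> k _; exact: cc'.
- move=> k kj; rewrite /observed_reward /action /covariate rj// ww'//.
  exact: leq_trans kj gn.
Qed.

(** If every event failed, [grid j <= tau j] would pass from each [j] to the next, and the last grid
    point [T] would be at most [tau M < T]. *)
Lemma batch_event_exhaustive s w : tau 0%N = 0%N -> (tau M < T)%N ->
  exists j : 'I_M, batch_event tau s j w.
Proof.
move=> n0 nM.
have [/fintype.existsP //|/fintype.existsPn H] := boolP [exists j : 'I_M, batch_event tau s j w].
have : (grid p M s w <= tau M)%N.
  suff : forall j, (j <= M)%N -> (grid p j s w <= tau j)%N by apply.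
  elim=> [_|j IH jM]; first by rewrite grid_first.
  by have := H (Ordinal jM); rewrite /batch_event /= IH ?(ltnW jM)//= -leqNgt.
by rewrite grid_last leqNgt nM.
Qed.

Lemma sum_batch_event s w : tau 0%N = 0%N -> (tau M < T)%N ->
  1 <= \sum_(j < M) (batch_event tau s j w)%:R :> R.
Proof.
move=> n0 nM; have [j wj] := batch_event_exhaustive s w n0 nM.
by rewrite (bigD1 j)//= wj lerDl sumr_ge0.
Qed.

Lemma measurable_batch_event s j : (j < M)%N ->
  measurable_fun [set: path] (batch_event tau s j).
Proof.
move=> jM; have mg l : (l <= M)%N -> measurable_fun [set: path] (fun w => grid p l s w).
  by move=> lM; exact: (measurable_fun_pair2 s (grid_measurable p lM)).
by apply: measurable_and; [apply: measurable_fun_leq|apply: measurable_fun_ltn];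
  rewrite //; apply: mg => //; exact: ltnW.
Qed.

Lemma measurable_joint_action (i : 'I_T) :
  measurable_fun [set: S * path] (fun z => action (rule p) z.1 z.2 i).
Proof.
have mp : measurable_fun [set: S * path] (fun z : S * path => (z, covariate z.2 i)).
  apply: measurable_fun_pair; first exact: measurable_id.
  exact: (measurableT_comp (measurable_covariate i) measurable_snd).
exact: (measurableT_comp (rule_measurable p i) mp).
Qed.

Lemma measurable_action s (i : 'I_T) :
  measurable_fun [set: path] (fun w => action (rule p) s w i).
Proof. exact: (measurable_fun_pair2 s (measurable_joint_action i)). Qed.

End policy.

(** * Regression gaps made of disjoint spikes *)

Section gap.
Variables (R : realType) (d : nat) (C : finType) (psi : C -> d.-tuple R -> R).
Hypotheses (hpsi : forall c, mnn (psi c))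
  (disj : forall c c' x, c != c' -> psi c x * psi c' x = 0).
Implicit Types (theta : C -> R) (x y : d.-tuple R).

Definition gap theta x : R := \sum_c theta c * psi c x.

Definition pm1 (b : bool) : R := if b then 1 else -1.

Lemma psi_cases x : (forall c, psi c x = 0) \/
  exists c0, 0 < psi c0 x /\ forall c, c != c0 -> psi c x = 0.
Proof.
have [/fintype.existsP[c0 p0]|/fintype.existsPn H] := boolP [exists c, 0 < psi c x].
  right; exists c0; split=> // c cc0.
  by have /eqP := disj x cc0; rewrite mulf_eq0 (gt_eqF p0) orbF => /eqP.
by left => c; apply/le_anti; rewrite (hpsi c).2 leNgt H.
Qed.

Lemma gap_only theta x c0 : (forall c, c != c0 -> psi c x = 0) ->
  gap theta x = theta c0 * psi c0 x.
Proof.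
move=> H; rewrite /gap (bigD1 c0)//= big1 ?addr0// => c cc0.
by rewrite H ?mulr0.
Qed.

Lemma gap_none theta x : (forall c, psi c x = 0) -> gap theta x = 0.
Proof. by move=> H; rewrite /gap big1// => c _; rewrite H mulr0. Qed.

Lemma measurable_gap theta : measurable_fun [set: d.-tuple R] (gap theta).
Proof.
rewrite /gap; elim: (index_enum _) => [|c s IH].
  by rewrite (_ : (fun _ => _) = fun=> 0)//; apply/funext => x; rewrite big_nil.
rewrite (_ : (fun _ => _) = fun x => theta c * psi c x +
  \sum_(j <- s) theta j * psi j x); last by apply/funext => x; rewrite big_cons.
by apply: measurable_funD => //; apply: measurable_funM => //; exact: (hpsi c).1.
Qed.

Lemma gap_bound theta K x : 0 <= K -> (forall c, `|theta c| <= 1) ->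
  (forall c x, psi c x <= K) -> `|gap theta x| <= K.
Proof.
move=> K0 t1 pK; have [/gap_none ->|[c0 [p0 /gap_only ->]]] := psi_cases x.
  by rewrite normr0.
rewrite normrM (gtr0_norm p0); apply: le_trans (pK c0 x).
by rewrite -[leRHS]mul1r ler_wpM2r// ltW.
Qed.

(** The factor 2 arises when [x] and [y] lie in different spikes: each spike vanishes at the other
    point, so each of the two values is an increment of one spike. *)
Lemma gap_holder theta (e : R) x y : 0 <= e -> (forall c, `|theta c| <= 1) ->
  (forall c, `|psi c x - psi c y| <= e) -> `|gap theta x - gap theta y| <= 2 * e.
Proof.
move=> e0 t1 pe.
have single c : `|theta c * (psi c x - psi c y)| <= e.
  by rewrite normrM -[leRHS]mul1r ler_pM.
have [x0|[c [_ cx]]] := psi_cases x; have [y0|[c' [_ cy]]] := psi_cases y.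
- by rewrite !gap_none// subr0 normr0 mulr_ge0.
- rewrite (gap_none _ x0) (gap_only _ cy).
  by have := single c'; rewrite x0 !sub0r mulrN => h; apply: le_trans h _; lra.
- rewrite (gap_none _ y0) (gap_only _ cx).
  by have := single c; rewrite y0 !subr0 => h; apply: le_trans h _; lra.
rewrite (gap_only _ cx) (gap_only _ cy).
have [<-|cc'] := eqVneq c c'.
  by rewrite -mulrBr; apply: le_trans (single c) _; lra.
apply: le_trans (ler_normB _ _) _.
have := single c; rewrite (cy c)// subr0.
have := single c'; rewrite (cx c') 1?eq_sym// sub0r mulrN normrN; lra.
Qed.

Lemma gap_margin theta delta x : (forall c, theta c = 0 \/ `|theta c| = 1) ->
  ((0 < `|gap theta x|) && (`|gap theta x| <= delta))%:R <=
  \sum_(c | theta c != 0) ((0 < psi c x) && (psi c x <= delta))%:R :> R.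
Proof.
move=> t01; have s0 : 0 <= \sum_(c | theta c != 0)
    ((0 < psi c x) && (psi c x <= delta))%:R :> R.
  by apply: sumr_ge0 => c _; exact: ler0n.
have [/gap_none ->|[c0 [p0 /gap_only ->]]] := psi_cases x.
  by rewrite normr0 ltxx.
have [->|t1] := t01 c0; first by rewrite mul0r normr0 ltxx.
rewrite normrM t1 mul1r gtr0_norm// (bigD1 c0)/=; last first.
  by rewrite -normr_eq0 t1 oner_eq0.
by rewrite lerDl; apply: sumr_ge0 => c _; exact: ler0n.
Qed.

(** Regret of pulling [a] when the gap is [f], left unsimplified so that the regret of a
    [bern_instance] is a sum of such terms by conversion. *)
Definition cost (f : R) (a : arm) : R :=
  Num.max (2^-1 + f) 2^-1 - (if a then 2^-1 + f else 2^-1).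

Lemma costE f a : cost f a = if a then Num.max 0 (- f) else Num.max 0 f.
Proof.
rewrite /cost; case: a; case: (leP (2^-1 + f) 2^-1) => h1; case: leP => h2; lra.
Qed.

(** At most one spike is positive at [x], so at most one summand survives. Signs are prescribed on
    [A] only, which lets the same bound serve a single spike and a whole scale. *)
Lemma cost_gap_ge theta (om : C -> bool) (A : {pred C}) x a :
  (forall c, c \in A -> theta c = pm1 (om c)) ->
  \sum_(c in A) (a != om c)%:R * psi c x <= cost (gap theta x) a.
Proof.
move=> hA; rewrite costE.
have m0 : 0 <= (if a then Num.max 0 (- gap theta x) else Num.max 0 (gap theta x)).
  by case: a; rewrite le_max lexx.
have [H|[c0 [p0 H]]] := psi_cases x.
  by rewrite big1// => c _; rewrite H mulr0.
have [c0A|c0A] := boolP (c0 \in A); last first.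
  rewrite big1// => c cA; rewrite H ?mulr0//.
  by apply: contraNneq c0A => <-.
rewrite (bigD1 c0)//= big1 ?addr0; last first.
  by move=> c /andP[_ cc0]; rewrite H ?mulr0.
rewrite (gap_only _ H) hA// in m0 *.
case: eqVneq => [_|ne]; first by rewrite mul0r.
rewrite mul1r /pm1; case: a ne {m0}; case: (om c0) => // _.
  by rewrite mulN1r opprK le_max lexx orbT.
by rewrite mul1r le_max lexx orbT.
Qed.

End gap.

(** * Smoothness and margin condition of a sum of spikes *)

Section class_membership.
Variables (R : realType) (d : nat) (C : finType) (lo : C -> 'I_d -> R) (h : C -> R).
Variables (kappa beta alpha L : R) (theta : C -> R).
Local Notation PX := (uniform_cube R d).
Local Notation psi := (fun c => spike (lo c) (h c) kappa beta).
Hypotheses (d0 : (0 < d)%N) (h0 : forall c, 0 < h c) (k0 : 0 < kappa) (b01 : 0 < beta <= 1)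
  (a0 : 0 < alpha) (ab1 : alpha * beta <= 1) (kL : 2 * kappa <= L).
Hypotheses (lo0 : forall c i, 0 <= lo c i) (lo1 : forall c i, lo c i + h c <= 1).
Hypothesis disj : forall c c' x, c != c' -> psi c x * psi c' x = 0.
Hypothesis t01 : forall c, theta c = 0 \/ `|theta c| = 1.
Hypothesis mass : \sum_(c | theta c != 0) h c `^ (d%:R - alpha * beta) <= 1.
Hypotheses (mg : measurable_fun [set: d.-tuple R] (gap psi theta))
  (g12 : forall x, `|gap psi theta x| <= 2^-1).

(** Smoothness costs the factor 2 of [gap_holder], covered by [kL]. For the margin, the layers of
    the active spikes are added up, and [mass] says that their weights [h^(d - alpha beta)] fit into
    the budget. *)
Lemma in_class_spike (delta0 : R) :
  in_class (bern_instance PX mg g12) alpha beta L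
    (2 * d%:R * kappa^-1 `^ alpha) delta0.
Proof.
have hpsi c : mnn (psi c) by exact: mnn_spike.
have t1 c : `|theta c| <= 1.
  by case: (t01 c) => ->; rewrite ?normr0.
split.
  move=> k x y _ _ /=; rewrite /bern_regression; case: k; last first.
    by rewrite subrr normr0 mulr_ge0 ?powR_ge0//; have := kL; have := k0; lra.
  rewrite (_ : _ - _ = gap psi theta x - gap psi theta y); last by ring.
  apply: le_trans (_ : 2 * (kappa * dist2 x y `^ beta) <= _); last first.
    by rewrite mulrA ler_wpM2r ?powR_ge0.
  apply: gap_holder => //; first by rewrite mulr_ge0 ?powR_ge0// ltW.
  by move=> c; exact: spike_holder.
move=> delta /andP[de0 _] /=.
rewrite (_ : [set x | _] = [set x | (0 < `|gap psi theta x|) && (`|gap psi theta x| <= delta)]); last first.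
  apply/seteqP; split => x /=; rewrite /bern_regression;
    by rewrite (_ : _ - _ = gap psi theta x)//; ring.
have mb (g : d.-tuple R -> R) : measurable_fun setT g ->
    measurable_fun setT (fun x => (0 < g x) && (g x <= delta)).
  by move=> mgg; apply: measurable_and; [exact: measurable_fun_ltr|exact: measurable_fun_ler].
have mng : measurable_fun setT (fun x => `|gap psi theta x|) by exact: measurableT_comp.
rewrite (probability_bool PX (mb _ mng)).
apply: (@le_trans _ _ (\int[PX]_x
  (\sum_(c | theta c != 0) ((0 < psi c x) && (psi c x <= delta))%:R)%:E)%E).
  apply: mnn_integral_le.
  - exact: mnn_bool (mb _ mng).
  - by apply: mnn_sum => c _; apply: mnn_bool; apply: mb; exact: (hpsi c).1.
  - by move=> x; apply: gap_margin.
rewrite mnn_integral_sum; last first.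
  by move=> c _; apply: mnn_bool; apply: mb; exact: (hpsi c).1.
set D0 := 2 * _ * _.
have D00 : 0 <= D0 by rewrite !mulr_ge0// powR_ge0.
apply: le_trans.
  apply: lee_sum => c _.
  exact: (integral_spike_margin (h0 c) k0 b01 (lo0 c) (lo1 c) d0 a0 ab1 de0).
rewrite sumEFin lee_fin -mulr_suml -mulr_sumr.
by apply: ler_wpM2r; [exact: powR_ge0|rewrite -[leRHS]mulr1 ler_wpM2l].
Qed.

End class_membership.

(** * Averaging over random signs *)

Section real_expectation.
Context {dT : measure_display} {T : measurableType dT} {R : realType}.
Variable P : probability T R.
Implicit Types F G : T -> R.

(** Boundedness makes the integral against a probability finite, so that averages can be treated as
    real numbers and subtracted. *)
Definition bnn F := mnn F /\ exists K, forall x, F x <= K.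

Definition mean F : R := fine (\int[P]_x (F x)%:E)%E.

Lemma meanE F : bnn F -> (\int[P]_x (F x)%:E = (mean F)%:E)%E.
Proof.
move=> [hF [K FK]]; rewrite /mean fineK// ge0_fin_numE; last exact: mnn_integral_ge0.
apply: (@le_lt_trans _ _ (\int[P]_x (`|K|%R)%:E)%E).
  apply: mnn_integral_le => //.
  by move=> x; apply: le_trans (FK x) (ler_norm _).
by rewrite integral_cst// [X in (_ * X)%E]probability_setT mule1 ltry.
Qed.

Lemma bnn_cst (r : R) : 0 <= r -> bnn (fun=> r).
Proof. by move=> r0; split; [exact: mnn_cst|exists r]. Qed.

Lemma bnn_bool (b : T -> bool) : measurable_fun [set: T] b -> bnn (fun x => (b x)%:R).
Proof. by move=> mb; split; [exact: mnn_bool|exists 1 => x; rewrite lern1 leq_b1]. Qed.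

Lemma bnnM F G : bnn F -> bnn G -> bnn (fun x => F x * G x).
Proof.
move=> [hF [K FK]] [hG [K' GK]]; split; first exact: mnnM.
by exists (K * K') => x; apply: ler_pM => //; [exact: hF.2|exact: hG.2].
Qed.

Lemma bnn_sum (I : Type) (s : seq I) (Q : pred I) (F : I -> T -> R) :
  (forall i, Q i -> bnn (F i)) -> bnn (fun x => \sum_(i <- s | Q i) F i x).
Proof.
move=> H; split; first by apply: mnn_sum => i Qi; exact: (H i Qi).1.
elim: s => [|i s [K IH]]; first by exists 0 => x; rewrite big_nil.
have [Qi|Qi] := boolP (Q i); last first.
  by exists K => x; rewrite big_cons (negbTE Qi).
have [K' FK'] := (H i Qi).2; exists (K' + K) => x.
by rewrite big_cons Qi lerD.
Qed.

Lemma mean_ge0 F : mnn F -> 0 <= mean F.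
Proof. by move=> hF; rewrite /mean fine_ge0// mnn_integral_ge0. Qed.

Lemma mean_le F G : bnn F -> bnn G -> (forall x, F x <= G x) -> mean F <= mean G.
Proof.
by move=> hF hG FG; rewrite -lee_fin -!meanE//; apply: mnn_integral_le; [exact: hF.1|exact: hG.1|].
Qed.

Lemma mean_cst (r : R) : mean (fun=> r) = r.
Proof. by rewrite /mean integral_cst// [X in (_ * X)%E]probability_setT mule1. Qed.

Lemma mean_sum (I : Type) (s : seq I) (Q : pred I) (F : I -> T -> R) :
  (forall i, Q i -> bnn (F i)) ->
  mean (fun x => \sum_(i <- s | Q i) F i x) = \sum_(i <- s | Q i) mean (F i).
Proof.
move=> H; apply: EFin_inj; rewrite -meanE; last exact: bnn_sum.
rewrite mnn_integral_sum; last by move=> i Qi; exact: (H i Qi).1.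
by rewrite -sumEFin; apply: eq_bigr => i Qi; rewrite meanE//; exact: H.
Qed.

End real_expectation.

Section mixture.
Variables (R : realType) (d T M : nat) (PX : probability (d.-tuple R) R).
Variables (dS : measure_display) (S : measurableType dS).
Variable p : batch_policy R d T S M.
Variables (C : finType) (psi : C -> d.-tuple R -> R).
Hypotheses (hpsi : forall c, mnn (psi c)) (psib : forall c x, psi c x <= 4^-1)
  (disj : forall c c' x, c != c' -> psi c x * psi c' x = 0).
Variable tau : nat -> nat.
Local Notation path := (T.-tuple (datum R d)).
Implicit Types (theta : C -> R) (s : S) (w : path).

Definition law theta := bern_law PX (measurable_gap hpsi theta).

Definition step_cost theta s (i : 'I_T) w :=
  cost (gap psi theta (tnth w i).1) (action (rule p) s w i).

Definition path_cost theta s w := \sum_(i < T) step_cost theta s i w.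

Definition mean_regret theta s := mean (iid_law (law theta) T) (path_cost theta s).

Definition event_prob theta s j :=
  mean (iid_law (law theta) T) (fun w => (batch_event p tau s j w)%:R).

(** The part of the cost of round [i] charged to spike [c] when [b] is the right arm there. *)
Definition cell_cost s j (i : 'I_T) c b w : R :=
  (batch_event p tau s j w && (action (rule p) s w i != b))%:R * psi c (tnth w i).1.

Definition mean_cell_cost theta s j i c b :=
  mean (iid_law (law theta) T) (cell_cost s j i c b).

Lemma gap_quarter theta x : (forall c, `|theta c| <= 1) -> `|gap psi theta x| <= 4^-1.
Proof. by move=> t1; apply: gap_bound => //; rewrite invr_ge0. Qed.

Lemma bnn_cell_cost s j i c b : (j < M)%N -> bnn (cell_cost s j i c b).
Proof.
move=> jM; apply: bnnM; last first.
  split; first by apply: (mnn_comp (hpsi c)); exact: measurable_covariate.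
  by exists 4^-1 => w; exact: psib.
apply: bnn_bool; apply: measurable_and; first exact: measurable_batch_event.
apply: (measurableT_comp (f := fun a : bool => a != b)) => //.
exact: measurable_action.
Qed.

Lemma measurable_joint_cost theta (i : 'I_T) : measurable_fun [set: S * path]
  (fun z => cost (gap psi theta (tnth z.2 i).1) (action (rule p) z.1 z.2 i)).
Proof.
have mX : measurable_fun [set: S * path] (fun z => gap psi theta (tnth z.2 i).1).
  apply: (measurableT_comp (measurable_gap hpsi theta)).
  exact: (measurableT_comp (measurable_covariate i) measurable_snd).
have -> : (fun z : S * path => cost (gap psi theta (tnth z.2 i).1)
    (action (rule p) z.1 z.2 i)) = fun z => if action (rule p) z.1 z.2 i
    then Num.max 0 (- gap psi theta (tnth z.2 i).1)
    else Num.max 0 (gap psi theta (tnth z.2 i).1).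
  by apply/funext => z; rewrite costE.
apply: measurable_fun_ifT; first exact: measurable_joint_action.
  by apply: measurable_maxr => //; exact: measurableT_comp.
exact: measurable_maxr.
Qed.

Lemma mnn_joint_cost theta : mnn (fun z : S * path => path_cost theta z.1 z.2).
Proof.
apply: mnn_sum => i _; split; first exact: measurable_joint_cost.
by move=> z; rewrite /step_cost costE; case: ifP => _; rewrite le_max lexx.
Qed.

Lemma bnn_path_cost theta s : (forall c, `|theta c| <= 1) -> bnn (path_cost theta s).
Proof.
move=> t1; apply: bnn_sum => i _; split.
  split; first exact: (measurable_fun_pair2 s (measurable_joint_cost theta i)).
  by move=> w; rewrite /step_cost costE; case: ifP => _; rewrite le_max lexx.
exists 4^-1 => w; rewrite /step_cost costE.
have := gap_quarter (tnth w i).1 t1; rewrite ler_norml => /andP[h1 h2].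
by case: ifP => _; rewrite ge_max invr_ge0 ler0n/=; lra.
Qed.

Lemma regretE theta (g12 : forall x, `|gap psi theta x| <= 2^-1) (nu : probability S R) :
  (forall c, `|theta c| <= 1) ->
  (regret nu p (bern_instance PX (measurable_gap hpsi theta) g12) =
   \int[nu]_s (mean_regret theta s)%:E)%E.
Proof.
move=> t1; rewrite /regret unlock.
transitivity (\int[nu \x iid_law (law theta) T]_z (path_cost theta z.1 z.2)%:E)%E.
  (* The summands of [path_regret] unfold to [cost] by conversion. *)
  by [].
have hz := mnn_joint_cost theta.
rewrite (@fubini_tonelli1 _ _ _ _ _ nu (iid_law (law theta) T)
  (fun z => (path_cost theta z.1 z.2)%:E)); last 2 first.
- exact: mnn_EFin.
- by move=> z; rewrite lee_fin; exact: hz.2.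
apply: eq_integral => s _; rewrite /fubini_F /=.
exact: (meanE _ (bnn_path_cost s t1)).
Qed.

Definition upd theta c v : C -> R := fun c' => if c' == c then v else theta c'.

Lemma gap_upd theta c v x :
  gap psi (upd theta c v) x = gap psi (upd theta c 0) x + v * psi c x.
Proof.
rewrite /gap (bigD1 c)//= [in RHS](bigD1 c)//= /upd eqxx mul0r add0r addrC.
by congr (_ + _); apply: eq_bigr => c' /negbTE ->.
Qed.

Lemma gap_upd0_disj theta c x : gap psi (upd theta c 0) x * psi c x = 0.
Proof.
rewrite /gap mulr_suml big1// => c' _; rewrite /upd; case: eqVneq => [_|cc'].
  by rewrite !mul0r.
by rewrite -mulrA disj// mulr0.
Qed.

(** Laws carry a measurability proof, so pointwise equal gaps written differently give different
    terms; extensionality and proof irrelevance identify them. *)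
Lemma mean_law_gap theta f (mf : measurable_fun [set: d.-tuple R] f) F :
  (forall x, f x = gap psi theta x) ->
  mean (iid_law (bern_law PX mf) T) F = mean (iid_law (law theta) T) F.
Proof.
move=> /funext fE; rewrite /law; move: (measurable_gap _ _); rewrite -fE => mg.
by rewrite (Prop_irrelevance mf mg).
Qed.

Variable s : S.

(* Knowing only the rewards of the first [tau j] rounds, the learner confuses the
   two signs of the bump [c] up to the chi-square distance [(1 + q)^(tau j) - 1]. *)
Lemma cell_bound theta j (i : 'I_T) c (e q : R) : (j < M)%N ->
  (tau j <= i <= tau j.+1)%N -> (forall c, `|theta c| <= 1) ->
  (\int[PX]_x (psi c x)%:E = e%:E)%E -> (\int[PX]_x (4 * psi c x ^+ 2)%:E = q%:E)%E ->
  e / 8 * (2 * event_prob (upd theta c 0) s j + event_prob (upd theta c 1) s j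
    + event_prob (upd theta c (- 1)) s j) <=
  mean_cell_cost (upd theta c 1) s j i c true +
  mean_cell_cost (upd theta c (- 1)) s j i c false + 4 * e * ((1 + q) ^+ tau j - 1).
Proof.
move=> jM iN t1 eE qE; have /andP[ni iN'] := iN.
set f0 := gap psi (upd theta c 0).
have mf0 : measurable_fun [set: d.-tuple R] f0 := measurable_gap hpsi _.
have f0b x : `|f0 x| <= 4^-1.
  by apply: gap_quarter => c'; rewrite /upd; case: eqP => _ //; rewrite normr0.
have pb x : 0 <= psi c x <= 4^-1 by rewrite (hpsi c).2 psib.
have mD : measurable_fun [set: d.-tuple R] (fun x => f0 x + psi c x).
  by apply: measurable_funD => //; exact: (hpsi c).1.
have mB : measurable_fun [set: d.-tuple R] (fun x => f0 x - psi c x).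
  by apply: measurable_funB => //; exact: (hpsi c).1.
have mA := measurable_batch_event p tau s jM.
have ma := measurable_action p s i.
have := two_point_bound mf0 f0b ni (hpsi c).1 pb (gap_upd0_disj theta c) eE qE mD mB
  mA ma (fun w w' ww' => batch_event_agree p s jM ww')
  (fun w w' ww' cc' ew => batch_action_agree jM ww' cc' iN ew).
have bA : bnn (fun w => (batch_event p tau s j w)%:R : R) := bnn_bool mA.
have bc b := bnn_cell_cost s i c b jM.
have gD x : f0 x + psi c x = gap psi (upd theta c 1) x by rewrite gap_upd mul1r.
have gB x : f0 x - psi c x = gap psi (upd theta c (- 1)) x by rewrite gap_upd mulN1r.
under [X in (_ <= X + _ + _)%E -> _]eq_integral => w _.
  rewrite (_ : _ * _ = cell_cost s j i c true w); last first.
    by rewrite /cell_cost; case: (action _ _ _ _).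
  over.
under [X in (_ <= _ + X + _)%E -> _]eq_integral => w _.
  rewrite (_ : _ * _ = cell_cost s j i c false w); last first.
    by rewrite /cell_cost; case: (action _ _ _ _).
  over.
rewrite !(meanE _ bA) (meanE _ (bc true)) (meanE _ (bc false)).
rewrite (mean_law_gap (theta := upd theta c 0) mf0)// !(mean_law_gap mD _ gD).
by rewrite !(mean_law_gap mB _ gB) -lee_fin.
Qed.

Definition slots j : R := \sum_(i < T | (tau j <= i <= tau j.+1)%N) 1.

Lemma event_prob_ge0 theta j : (j < M)%N -> 0 <= event_prob theta s j.
Proof. by move=> jM; apply: mean_ge0; apply: mnn_bool; exact: measurable_batch_event. Qed.

Lemma sum_event_prob theta : tau 0%N = 0%N -> (tau M < T)%N ->
  1 <= \sum_(j < M) event_prob theta s j.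
Proof.
move=> n0 nM; have b (j : 'I_M) : bnn (fun w => (batch_event p tau s j w)%:R : R).
  by apply: bnn_bool; exact: measurable_batch_event.
rewrite -mean_sum// -[leLHS](mean_cst (iid_law (law theta) T)).
apply: mean_le; first exact: bnn_cst.
  exact: bnn_sum.
by move=> w; exact: sum_batch_event.
Qed.

Lemma mean_regret_ge0 theta : (forall c, `|theta c| <= 1) -> 0 <= mean_regret theta s.
Proof. by move=> t1; apply: mean_ge0; exact: (bnn_path_cost s t1).1. Qed.

Lemma mean_regret_ge theta (om : C -> bool) (A : {set C}) j : (j < M)%N ->
  (forall c, `|theta c| <= 1) -> (forall c, c \in A -> theta c = pm1 R (om c)) ->
  \sum_(i < T | (tau j <= i <= tau j.+1)%N) \sum_(c in A) mean_cell_cost theta s j i c (om c)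
  <= mean_regret theta s.
Proof.
move=> jM t1 tA.
have bc i c b : bnn (cell_cost s j i c b) by exact: bnn_cell_cost.
have bsum i : bnn (fun w => \sum_(c in A) cell_cost s j i c (om c) w).
  by apply: bnn_sum => c _.
under eq_bigr do rewrite -mean_sum//.
rewrite -mean_sum//; apply: mean_le; [exact: bnn_sum|exact: bnn_path_cost|].
move=> w; rewrite /path_cost [leRHS](bigID (fun i : 'I_T => (tau j <= i <= tau j.+1)%N))/=.
rewrite -[leLHS]addr0; apply: lerD; last first.
  apply: sumr_ge0 => i _; rewrite /step_cost costE.
  by case: ifP => _; rewrite le_max lexx.
apply: ler_sum => i _; apply: le_trans (cost_gap_ge hpsi disj _ _ tA).
apply: ler_sum => c _; rewrite /cell_cost ler_wpM2r ?(hpsi c).2// ler_nat.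
by case: (batch_event _ _ _ _ _).
Qed.

Variables (e q : C -> R) (Rstar : R).
Hypotheses (eE : forall c, (\int[PX]_x (psi c x)%:E = (e c)%:E)%E)
  (qE : forall c, (\int[PX]_x (4 * psi c x ^+ 2)%:E = (q c)%:E)%E).
Hypotheses (n0 : tau 0%N = 0%N) (nM : (tau M < T)%N) (M0 : (0 < M)%N).

Lemma e_ge0 c : 0 <= e c.
Proof. by rewrite -lee_fin -eE; exact: mnn_integral_ge0. Qed.

(** The reference is the instance without spikes, where some scale [j] has event probability at
    least [1/M]. Since [j] depends on [s], the sum runs over all [2 M] instances; this is the source
    of the second factor [M] in the hypothesis on [Rstar]. *)
Lemma single_scale_regret (cell : 'I_M -> C) :
  (forall j : 'I_M, 32 * M%:R * ((1 + q (cell j)) ^+ tau j - 1) <= 1) ->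
  (forall j : 'I_M, 16 * M%:R ^+ 2 * Rstar <= slots j * e (cell j)) ->
  #|{: 'I_M * bool}|%:R * Rstar <=
  \sum_(jb : 'I_M * bool) mean_regret (upd (fun=> 0) (cell jb.1) (pm1 R jb.2)) s.
Proof.
move=> hq hR; have M1 : 1 <= M%:R :> R by rewrite ler1n.
have Mp : 0 < M%:R :> R by rewrite ltr0n.
have t0 (c : C) : `|(fun=> 0 : R) c| <= 1 by rewrite normr0.
have t1 (c c' : C) b : `|upd (fun=> 0) c (pm1 R b) c'| <= 1.
  by rewrite /upd /pm1; case: eqP => _; case: b; rewrite ?normr0 ?normrN ?normr1.
have [j hj] : exists j : 'I_M, M%:R^-1 <= event_prob (fun=> 0) s j.
  apply/not_existsP => H; have := sum_event_prob (fun=> 0) n0 nM.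
  apply/negP; rewrite -ltNge.
  have : \sum_(j < M) event_prob (fun=> 0) s j < \sum_(j < M) M%:R^-1.
    apply: ltr_sum => [|j _]; last by rewrite ltNge; apply/negP; exact: H.
    by apply/hasP; exists (Ordinal M0); rewrite ?mem_index_enum.
  by rewrite sumr_const card_ord -[_ *+ M]mulr_natr mulVf// gt_eqF.
set c := cell j.
have e0 := e_ge0 c.
have upd0 : upd (fun=> 0) c 0 = fun=> 0 by apply/funext => c'; rewrite /upd; case: eqP.
(* The reference term alone gives [2 * e c / (8 M)], and the chi-square error takes at most half of
   it. *)
have step (i : 'I_T) : (tau j <= i <= tau j.+1)%N -> e c / (8 * M%:R) <=
    mean_cell_cost (upd (fun=> 0) c 1) s j i c true +
    mean_cell_cost (upd (fun=> 0) c (- 1)) s j i c false.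
  move=> iN; have := cell_bound (ltn_ord j) iN t0 (eE c) (qE c); rewrite upd0.
  have p1 := event_prob_ge0 (upd (fun=> 0) c 1) (ltn_ord j).
  have p2 := event_prob_ge0 (upd (fun=> 0) c (- 1)) (ltn_ord j).
  have hqj := hq j; rewrite -/c in hqj.
  have eq' : 4 * e c * ((1 + q c) ^+ tau j - 1) <= e c / (8 * M%:R).
    rewrite ler_pdivlMr; last by rewrite mulr_gt0.
    rewrite -[leRHS]mulr1 [leLHS](_ : _ = e c * (32 * M%:R * ((1 + q c) ^+ tau j - 1))).
      exact: ler_wpM2l.
    ring.
  have pp : e c / 8 * (2 * M%:R^-1) <= e c / 8 * (2 * event_prob (fun=> 0) s j +
      event_prob (upd (fun=> 0) c 1) s j + event_prob (upd (fun=> 0) c (- 1)) s j).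
    apply: ler_wpM2l; first by rewrite divr_ge0.
    by rewrite -addrA -[leLHS]addr0; apply: lerD; [exact: ler_wpM2l|exact: addr_ge0].
  have f1 : e c / 8 * (2 * M%:R^-1) = e c / (8 * M%:R) + e c / (8 * M%:R).
    by field; rewrite gt_eqF.
  move=> cb; rewrite -(lerD2r (e c / (8 * M%:R))) -f1.
  by apply: le_trans pp (le_trans cb _); rewrite lerD2l.
have reg : slots j * (e c / (8 * M%:R)) <= mean_regret (upd (fun=> 0) c 1) s +
    mean_regret (upd (fun=> 0) c (- 1)) s.
  have r1 := mean_regret_ge (om := fun=> true) (A := [set c]) (ltn_ord j) (t1 c ^~ true).
  have r2 := mean_regret_ge (om := fun=> false) (A := [set c]) (ltn_ord j) (t1 c ^~ false).
  apply: le_trans (lerD (r1 _) (r2 _)); last 2 first.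
  - by move=> c'; rewrite inE => /eqP ->; rewrite /upd eqxx.
  - by move=> c'; rewrite inE => /eqP ->; rewrite /upd eqxx.
  rewrite /slots mulr_suml -big_split/=; apply: ler_sum => i iN.
  by rewrite !big_set1 mul1r; exact: step.
have jne : (j, true) != (j, false) :> 'I_M * bool by rewrite xpair_eqE andbF.
rewrite (bigD1 (j, true))//= (bigD1 (j, false))/=; last by rewrite eq_sym jne.
rewrite card_prod card_ord card_bool addrA.
apply: le_trans (_ : slots j * (e c / (8 * M%:R)) <= _).
  have := hR j; rewrite -/c => h.
  rewrite mulrA ler_pdivlMr ?mulr_gt0// natrM; apply: le_trans h.
  by rewrite [leLHS](_ : _ = 16 * M%:R ^+ 2 * Rstar)//; ring.
rewrite -[leLHS]addr0; apply: lerD => //.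
by apply: sumr_ge0 => jb _; apply: mean_regret_ge0 => c'; exact: t1.
Qed.

Definition flip (c : C) (om : {ffun C -> bool}) : {ffun C -> bool} :=
  [ffun c' => if c' == c then ~~ om c' else om c'].

Lemma flipK c : involutive (flip c).
Proof.
by move=> om; apply/ffunP => c'; rewrite !ffunE; case: eqP => // _; rewrite negbK.
Qed.

(** Here the average runs over sign patterns. The scale [j] has average event probability at least
    [1/M] over all patterns, and the patterns are paired by flipping the sign of one spike; all
    spikes of scale [j] then contribute at once. *)
Lemma multi_scale_regret (act : 'I_M -> {set C}) :
  (forall (j : 'I_M) c, c \in act j -> 64 * M%:R * ((1 + q c) ^+ tau j - 1) <= 1) ->
  (forall j : 'I_M, 16 * M%:R * Rstar <= slots j * \sum_(c in act j) e c) ->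
  #|{ffun C -> bool}|%:R * Rstar <=
  \sum_(om : {ffun C -> bool}) mean_regret (fun c => pm1 R (om c)) s.
Proof.
move=> hq hR; have Mp : 0 < M%:R :> R by rewrite ltr0n.
set K : R := #|{ffun C -> bool}|%:R.
have K0 : 0 < K by rewrite ltr0n; apply/card_gt0P; exists [ffun=> true].
pose th (om : {ffun C -> bool}) c := pm1 R (om c).
have t1 om c : `|th om c| <= 1.
  by rewrite /th /pm1; case: (om c); rewrite ?normrN normr1.
pose Q j := \sum_om event_prob (th om) s j.
have [j hj] : exists j : 'I_M, K / M%:R <= Q j.
  apply/not_existsP => H.
  have : K <= \sum_(j < M) Q j.
    rewrite exchange_big/= /K -sumr_const; apply: ler_sum => om _.
    exact: sum_event_prob.
  apply/negP; rewrite -ltNge.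
  have : \sum_(j < M) Q j < \sum_(j < M) K / M%:R.
    apply: ltr_sum => [|j _]; last by rewrite ltNge; apply/negP; exact: H.
    by apply/hasP; exists (Ordinal M0); rewrite ?mem_index_enum.
  by rewrite sumr_const card_ord -[_ *+ M]mulr_natr divfK// gt_eqF.
have step (i : 'I_T) c : (tau j <= i <= tau j.+1)%N -> c \in act j ->
    K * (e c / (16 * M%:R)) <= \sum_om mean_cell_cost (th om) s j i c (om c).
  move=> iN cj; have e0 := e_ge0 c.
  have flipE om : flip c om c = ~~ om c by rewrite ffunE eqxx.
  have splitE (F : {ffun C -> bool} -> R) :
      \sum_om F om = \sum_(om : {ffun C -> bool} | om c) (F om + F (flip c om)).
    rewrite (bigID (fun om : {ffun C -> bool} => om c))/= big_split/=; congr (_ + _).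
    rewrite (reindex_inj (inv_inj (flipK c)))/=; apply: eq_bigl => om.
    by rewrite flipE negbK.
  have eq' : 4 * e c * ((1 + q c) ^+ tau j - 1) <= e c / (16 * M%:R).
    rewrite ler_pdivlMr; last by rewrite mulr_gt0.
    rewrite -[leRHS]mulr1 [leLHS](_ : _ = e c * (64 * M%:R * ((1 + q c) ^+ tau j - 1))).
      by apply: ler_wpM2l => //; exact: hq.
    ring.
  (* The reference term of [cell_bound] is dropped; the events under the two signs add up to [Q j]
     once all pairs are summed. *)
  have pair (om : {ffun C -> bool}) : om c -> e c / 8 * (event_prob (th om) s j + event_prob (th (flip c om)) s j) <=
      mean_cell_cost (th om) s j i c (om c) +
      mean_cell_cost (th (flip c om)) s j i c (flip c om c) + e c / (16 * M%:R).
    move=> omc; have := cell_bound (ltn_ord j) iN (t1 om) (eE c) (qE c).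
    have -> : upd (th om) c 1 = th om.
      apply/funext => c'; rewrite /upd; case: eqP => // ->.
      by rewrite /th omc.
    have -> : upd (th om) c (- 1) = th (flip c om).
      by apply/funext => c'; rewrite /upd /th ffunE; case: eqP => // ->; rewrite omc.
    rewrite flipE omc => cb; apply: le_trans (le_trans cb _).
      by apply: ler_wpM2l; [rewrite divr_ge0|rewrite -addrA lerDr mulr_ge0// event_prob_ge0].
    by rewrite lerD2l.
  have : e c / 8 * Q j <= \sum_om mean_cell_cost (th om) s j i c (om c) +
      K * (e c / (16 * M%:R)).
    rewrite /Q !splitE mulr_sumr.
    apply: (@le_trans _ _ (\sum_(om : {ffun C -> bool} | om c)
      (mean_cell_cost (th om) s j i c (om c) +
      mean_cell_cost (th (flip c om)) s j i c (flip c om c) + e c / (16 * M%:R)))).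
      by apply: ler_sum => om omc; exact: pair.
    (* The number of pairs is bounded crudely by the number [K] of patterns. *)
    rewrite big_split/= lerD2l sumr_const -[_ *+ _]mulr_natl.
    apply: ler_wpM2r; first by rewrite divr_ge0// mulr_ge0// ltW.
    by rewrite ler_nat; exact: max_card.
  have : e c / 8 * (K / M%:R) <= e c / 8 * Q j by apply: ler_wpM2l => //; rewrite divr_ge0.
  have -> : e c / 8 * (K / M%:R) = K * (e c / (16 * M%:R)) + K * (e c / (16 * M%:R)).
    by field; rewrite gt_eqF.
  by move=> h1 h2; rewrite -(lerD2r (K * (e c / (16 * M%:R)))) (le_trans h1).
apply: (@le_trans _ _ (\sum_om \sum_(i < T | (tau j <= i <= tau j.+1)%N)
    \sum_(c in act j) mean_cell_cost (th om) s j i c (om c))); last first.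
  by apply: ler_sum => om _; exact: (mean_regret_ge (om := om)).
rewrite exchange_big/=.
apply: (@le_trans _ _ (\sum_(i < T | (tau j <= i <= tau j.+1)%N)
    \sum_(c in act j) K * (e c / (16 * M%:R)))); last first.
  apply: ler_sum => i iN; rewrite exchange_big/=.
  by apply: ler_sum => c cj; exact: step.
have -> : \sum_(i < T | (tau j <= i <= tau j.+1)%N) \sum_(c in act j) K * (e c / (16 * M%:R))
    = (slots j * \sum_(c in act j) e c) * (K / (16 * M%:R)).
  rewrite /slots -mulrA mulr_suml; apply: eq_bigr => i _.
  by rewrite mul1r mulr_suml; apply: eq_bigr => c _; rewrite mulrCA.
apply: le_trans (_ : 16 * M%:R * Rstar * (K / (16 * M%:R)) <= _).
  rewrite [leRHS](_ : _ = K * Rstar)//; field; rewrite gt_eqF//.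
by apply: ler_wpM2r => //; rewrite divr_ge0// ?mulr_ge0// ltW.
Qed.

End mixture.

(** * Placing the spikes *)

Section averaging.
Variables (R : realType) (d T M : nat) (PX : probability (d.-tuple R) R).
Variables (dS : measure_display) (S : measurableType dS).
Variables (nu : probability S R) (p : batch_policy R d T S M).
Variables (C : finType) (psi : C -> d.-tuple R -> R).
Hypotheses (hpsi : forall c, mnn (psi c)) (psib : forall c x, psi c x <= 4^-1)
  (disj : forall c c' x, c != c' -> psi c x * psi c' x = 0).

Lemma bnn_mean_regret theta : (forall c, `|theta c| <= 1) ->
  bnn (mean_regret PX p hpsi theta).
Proof.
move=> t1; have hz := mnn_joint_cost p hpsi theta.
have b s : bnn (path_cost p psi theta s) by exact: bnn_path_cost.
split.
  split; last by move=> s; apply: mean_ge0; exact: (b s).1.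
  apply/measurable_EFinP.
  rewrite (_ : _ \o _ = fubini_F (iid_law (law PX hpsi theta) T)
    (fun z => (path_cost p psi theta z.1 z.2)%:E)); last first.
    by apply/funext => s; rewrite /fubini_F /= -meanE.
  apply: measurable_fun_fubini_tonelli_F; first exact: mnn_EFin.
  by move=> z; rewrite lee_fin; exact: hz.2.
exists (\sum_(i < T) 4^-1) => s.
rewrite -(mean_cst (iid_law (law PX hpsi theta) T) (\sum_(i < T) 4^-1)).
have c0 : 0 <= \sum_(i < T) 4^-1 :> R by apply: sumr_ge0 => i _; rewrite invr_ge0.
apply: mean_le => //; first exact: bnn_cst.
move=> w; apply: ler_sum => i _; rewrite /step_cost costE.
have := gap_quarter hpsi psib disj (tnth w i).1 t1; rewrite ler_norml => /andP[h1 h2].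
case: ifP => _; rewrite ge_max invr_ge0 ler0n/=; first by rewrite lerNl.
exact: h2.
Qed.

(** The bound on the sum holds for every [s]; integrating it over [nu] before choosing [om] gives
    one instance for the randomised policy, even if the instances responsible for the bound vary
    with [s]. *)
Lemma average_instance (Om : finType) (theta : Om -> C -> R) (Rstar : R) :
  (0 < #|Om|)%N -> (forall om c, `|theta om c| <= 1) ->
  (forall s, #|Om|%:R * Rstar <= \sum_om mean_regret PX p hpsi (theta om) s) ->
  exists om, forall g12 : (forall x, `|gap psi (theta om) x| <= 2^-1),
    (Rstar%:E <= regret nu p
      (bern_instance PX (measurable_gap hpsi (theta om)) g12))%E.
Proof.
move=> Om0 t1 H; have b om : bnn (mean_regret PX p hpsi (theta om)) by exact: bnn_mean_regret.
have [om hom] : exists om, Rstar <= mean nu (mean_regret PX p hpsi (theta om)).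
  apply/not_existsP => N.
  have : #|Om|%:R * Rstar <= \sum_om mean nu (mean_regret PX p hpsi (theta om)).
    (* Constants are integrated as nonnegative functions; a negative target is trivial. *)
    have [r0|r0] := leP 0 (#|Om|%:R * Rstar).
      rewrite -mean_sum// -[leLHS](mean_cst nu); apply: mean_le => //.
      - exact: bnn_cst.
      - exact: bnn_sum.
    by apply: (le_trans (ltW r0)); apply: sumr_ge0 => om _; apply: mean_ge0; exact: (b om).1.
  apply/negP; rewrite -ltNge mulr_natl -sumr_const; apply: ltr_sum.
    by case/card_gt0P: Om0 => om _; apply/hasP; exists om; rewrite ?mem_index_enum.
  by move=> om _; rewrite ltNge; apply/negP; exact: N.
exists om => g12; rewrite (regretE PX p hpsi psib disj)//.
by rewrite (meanE nu (b om)) lee_fin.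
Qed.

End averaging.

(** Cells are coded by integer coordinates; restricting the first one to [z] layers leaves at least
    [z * N^(d - 1)] cells, from which [m] distinct ones are taken. It is used with [N = M * z], so
    that the layers form the slab where the first coordinate is between [j / M] and
    [(j + 1) / M]. *)
Lemma grid_cells (d N z j m : nat) : (0 < d)%N -> (j.+1 * z <= N)%N ->
  (m <= z * N ^ d.-1)%N ->
  exists v : 'I_m -> 'I_d -> nat,
    [/\ forall k k', k != k' -> exists i, v k i != v k' i,
        forall k i, (v k i < N)%N &
        forall k (i : 'I_d), val i = 0%N -> (j * z <= v k i < j.+1 * z)%N].
Proof.
case: d => // d' _ jN mN.
pose F (i : 'I_d'.+1) : pred 'I_N := fun n => (i != ord0) || (j * z <= n < j.+1 * z)%N.
pose V : pred {ffun 'I_d'.+1 -> 'I_N} := family F.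
have cardF : (z <= #|F ord0|)%N.
  have shift (k : 'I_z) : (j * z + k < N)%N.
    by apply: leq_trans jN; rewrite mulSn addnC ltn_add2r.
  pose f (k : 'I_z) := Ordinal (shift k).
  have finj : injective f by move=> k k' [] /addnI /val_inj.
  rewrite -[leqLHS](card_ord z) -(fintype.card_image finj); apply/subset_leq_card/fintype.subsetP.
  move=> _ /fintype.imageP[k _ ->]; rewrite unfold_in /F eqxx /=.
  by rewrite leq_addr mulSn addnC ltn_add2r /=.
have cardV : (z * N ^ d' <= #|V|)%N.
  rewrite card_family foldrE big_map big_enum /= big_ord_recl; apply: leq_mul => //.
  rewrite (eq_bigr (fun=> N)) ?prod_nat_const ?card_ord// => i _.
  by rewrite -[RHS]card_ord; apply: eq_card.
have mV : (m <= #|V|)%N by exact: leq_trans cardV.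
pose w (k : 'I_m) : {ffun 'I_d'.+1 -> 'I_N} := enum_val (widen_ord mV k).
exists (fun k i => w k i); split.
- move=> k k' kk'; apply/fintype.existsP; apply: contraNT kk'.
  rewrite negb_exists => /fintype.forallP H; apply/eqP.
  have /enum_val_inj /(congr1 val) /= e : w k = w k'.
    by apply/ffunP => i; apply/val_inj/eqP; have := H i; rewrite negbK.
  exact/val_inj.
- by move=> k i; exact: ltn_ord.
- move=> k i i0; have /familyP/(_ i) : w k \in V by exact: enum_valP.
  by rewrite unfold_in /F (_ : i == ord0)//; apply/eqP/val_inj.
Qed.

(** The assumption keeps [(1 + q)^n <= 2] along the induction, so each step adds at most [2 * q]. *)
Lemma one_plus_expr_le {R : realFieldType} (q : R) n : 0 <= q -> n%:R * q <= 2^-1 ->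
  (1 + q) ^+ n - 1 <= 2 * (n%:R * q).
Proof.
move=> q0; elim: n => [_|n IH]; first by rewrite expr0 subrr !mul0r mulr0.
rewrite -natr1 mulrDl mul1r => h.
have n0 : 0 <= n%:R * q by rewrite mulr_ge0.
have {}IH : (1 + q) ^+ n - 1 <= 2 * (n%:R * q) by apply: IH; lra.
rewrite exprS; have e0 : 0 <= (1 + q) ^+ n by rewrite exprn_ge0// addr_ge0.
move: IH h e0 n0; set x := (1 + q) ^+ n; set y := n%:R * q => IH h e0 y0.
have : q * x <= q * 2 by apply: ler_wpM2l => //; lra.
lra.
Qed.

Section construction.
Variables (R : realType) (d M : nat) (alpha beta kappa : R).
Variables (z m : 'I_M -> nat) (v : forall j : 'I_M, 'I_(m j) -> 'I_d -> nat).
Hypotheses (d0 : (0 < d)%N) (z0 : forall j, (0 < z j)%N) (M0 : (0 < M)%N).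
Hypotheses (vinj : forall j (k k' : 'I_(m j)), k != k' -> exists i, v k i != v k' i)
  (vlt : forall j (k : 'I_(m j)) i, (v k i < M * z j)%N)
  (vslab : forall j (k : 'I_(m j)) (i : 'I_d), val i = 0%N ->
    (j * z j <= v k i < j.+1 * z j)%N).
Hypotheses (k0 : 0 < kappa) (k1 : kappa <= 32^-1) (b01 : 0 < beta <= 1).
Local Notation PX := (uniform_cube R d).

(** A slab of width [1 / M] consists of exactly [z j] layers of cells of this side. *)
Definition side j : R := (M * z j)%:R^-1.

Definition cell_index : finType := {j : 'I_M & 'I_(m j)}.

Implicit Type c : cell_index.

Definition corner c i : R := (v (tagged c : 'I_(m (tag c))) i)%:R * side (tag c).

Definition cell_spike c := spike (corner c) (side (tag c)) kappa beta.

Lemma Mz_gt0 j : 0 < (M * z j)%:R :> R.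
Proof. by rewrite ltr0n muln_gt0 M0 z0. Qed.

Lemma side_gt0 j : 0 < side j.
Proof. by rewrite invr_gt0 Mz_gt0. Qed.

Lemma side_le1 j : side j <= 1.
Proof. by rewrite invf_le1 ?Mz_gt0// ler1n muln_gt0 M0 z0. Qed.

Lemma corner_ge0 c i : 0 <= corner c i.
Proof. by rewrite mulr_ge0// ltW// side_gt0. Qed.

Lemma corner_le1 c i : corner c i + side (tag c) <= 1.
Proof.
rewrite /corner -[X in _ + X]mul1r -mulrDl natr1 ler_pdivrMr ?Mz_gt0// mul1r ler_nat.
exact: vlt.
Qed.

Lemma cell_spike_disj c c' x : c != c' -> cell_spike c x * cell_spike c' x = 0.
Proof.
move=> cc'; have [bc|/(spike0 (side_gt0 _) k0 b01) e] :=
    boolP (shrunk_box (corner c) (side (tag c)) 0 x); last by rewrite /cell_spike e mul0r.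
have [bc'|/(spike0 (side_gt0 _) k0 b01) e] :=
    boolP (shrunk_box (corner c') (side (tag c')) 0 x); last by rewrite /cell_spike e mulr0.
exfalso; move: cc' bc bc'; case: c => j k; case: c' => j' k'.
rewrite /shrunk_box /corner /= => cc' /fintype.forallP bc /fintype.forallP bc'.
have sep (a b : 'I_M) (ka : 'I_(m a)) (kb : 'I_(m b)) (i : 'I_d) :
    (v ka i).+1%:R * side a <= (v kb i)%:R * side b ->
    tnth x i < (v ka i)%:R * side a + side a - 0 ->
    (v kb i)%:R * side b + 0 < tnth x i -> False.
  by rewrite -natr1; nra.
have [jj'|jj'] := eqVneq j j'.
  move: k' cc' bc'; rewrite -jj' => k' cc' bc'.
  have kk' : k != k' by apply: contraNneq cc' => ->.
  have [i] := vinj kk'; have := bc i; have := bc' i => /andP[h1 h2] /andP[h3 h4].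
  rewrite neq_ltn => /orP[vv|vv].
    by apply: (sep j j k k' i) => //; rewrite ler_wpM2r ?ler_nat// ltW// side_gt0.
  by apply: (sep j j k' k i) => //; rewrite ler_wpM2r ?ler_nat// ltW// side_gt0.
pose i : 'I_d := Ordinal d0.
have /andP[h1 h2] := bc i; have /andP[h3 h4] := bc' i.
(* Slabs end at multiples of [1 / M] whatever the mesh of the scale, so spikes of different scales
   are separated along the first axis. *)
have slab (a b : 'I_M) (ka : 'I_(m a)) (kb : 'I_(m b)) : (a < b)%N ->
    (v ka i).+1%:R * side a <= (v kb i)%:R * side b.
  move=> ab; have /andP[_ u1] := vslab ka (erefl : val i = 0%N).
  have /andP[u2 _] := vslab kb (erefl : val i = 0%N).
  have sideE (j1 : 'I_M) n : (n * z j1)%:R * side j1 = n%:R / M%:R.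
    rewrite /side !natrM; field; rewrite !pnatr_eq0 -!lt0n z0 M0 //.
  apply: (@le_trans _ _ (b%:R / M%:R)).
    apply: (@le_trans _ _ (a.+1%:R / M%:R)).
      by rewrite -(sideE a) ler_wpM2r ?ler_nat// ltW// side_gt0.
    by rewrite ler_wpM2r ?invr_ge0// ler_nat.
  by rewrite -(sideE b) ler_wpM2r ?ler_nat// ltW// side_gt0.
have : (j != j' :> nat) by [].
rewrite neq_ltn => /orP[vv|vv].
  exact: (sep j j' k k' i (slab _ _ _ _ vv)).
exact: (sep j' j k' k i (slab _ _ _ _ vv)).
Qed.

Lemma mnn_cell_spike c : mnn (cell_spike c).
Proof. exact: mnn_spike. Qed.

Lemma side_powR_le1 j (k r : R) : 1 <= k -> 0 <= r -> (side j / k) `^ r <= 1.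
Proof.
move=> k1' r0; have -> : 1 = 1 `^ r :> R by rewrite powR1.
apply: ge0_ler_powR => //.
- by rewrite nnegrE divr_ge0 ?(ltW (side_gt0 j))// (le_trans ler01).
- by rewrite nnegrE.
- rewrite ler_pdivrMr ?mul1r; last exact: lt_le_trans k1'.
  exact: le_trans (side_le1 j) k1'.
Qed.

Lemma cell_spike_le c x : cell_spike c x <= 4^-1.
Proof.
apply: le_trans (spike_le _ (side_gt0 _) k0 b01 x) _.
apply: (@le_trans _ _ kappa); last by have := k1; lra.
rewrite -[leRHS]mulr1 ler_pM2l// side_powR_le1//; first by rewrite ler1n.
by case/andP: b01 => /ltW.
Qed.

Definition cell_mass c := mean PX (cell_spike c).

Definition cell_chi2 c := mean PX (fun x => 4 * cell_spike c x ^+ 2).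

Definition mass_bound j := kappa * (side j / 4) `^ beta * (side j / 2) ^+ d.

Lemma cell_massE c : (\int[PX]_x (cell_spike c x)%:E = (cell_mass c)%:E)%E.
Proof.
by apply: meanE; split; [exact: mnn_cell_spike|exists 4^-1; exact: cell_spike_le].
Qed.

Lemma cell_mass_ge c : mass_bound (tag c) <= cell_mass c.
Proof.
have [e eE] := integral_spike_ge (side_gt0 (tag c)) k0 b01 (corner_ge0 c) (corner_le1 c).
by have := cell_massE c; rewrite eE => -[->].
Qed.

Lemma cell_chi2E c : (\int[PX]_x (4 * cell_spike c x ^+ 2)%:E = (cell_chi2 c)%:E)%E.
Proof.
have [q qE _] := integral_spike_sqr (side_gt0 (tag c)) k0 b01 (corner_ge0 c) (corner_le1 c).
by rewrite /cell_chi2 /mean /cell_spike qE.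
Qed.

(** As [kappa <= 32^-1], [4 * kappa^2 <= 256^-1], so [n * q <= 256^-1 / M] and the likelihood
    variance is at most twice that. *)
Lemma cell_chi2_le c n : n%:R * side (tag c) `^ (2 * beta + d%:R) <= M%:R^-1 ->
  64 * M%:R * ((1 + cell_chi2 c) ^+ n - 1) <= 1.
Proof.
move=> hn; have Mp : 0 < M%:R :> R by rewrite ltr0n.
have [q qE /andP[q0 qle]] :=
  integral_spike_sqr (side_gt0 (tag c)) k0 b01 (corner_ge0 c) (corner_le1 c).
have -> : cell_chi2 c = q.
  by apply: EFin_inj; rewrite -cell_chi2E qE.
set h := side (tag c) in qle hn *.
have h0 : 0 < h by exact: side_gt0.
have qh : q <= 4 * kappa ^+ 2 * h `^ (2 * beta + d%:R).
  apply: le_trans qle _; rewrite powRD; last by rewrite (gt_eqF h0) implybT.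
  rewrite powR_mulrn ?(ltW h0)// exprMn [4 * (_ * _)]mulrA -[leLHS]mulrA.
  apply: ler_wpM2l; first by rewrite mulr_ge0// sqr_ge0.
  apply: ler_wpM2r; first by rewrite exprn_ge0// ltW.
  rewrite [2 * beta]mulrC powRrM powR_mulrn ?powR_ge0// ler_sqr ?nnegrE ?powR_ge0//.
  apply: ge0_ler_powR; rewrite ?nnegrE ?divr_ge0 ?(ltW h0)//.
    by case/andP: b01 => /ltW.
  by rewrite ler_pdivrMr// ler_peMr ?(ltW h0)// ler1n.
have nq : n%:R * q <= 256^-1 / M%:R.
  apply: (@le_trans _ _ (4 * kappa ^+ 2 * (n%:R * h `^ (2 * beta + d%:R)))).
    by rewrite mulrCA ler_wpM2l.
  apply: ler_pM => //; first by rewrite mulr_ge0// sqr_ge0.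
    by rewrite mulr_ge0// powR_ge0.
  have : kappa ^+ 2 <= (32^-1) ^+ 2 by rewrite ler_sqr ?nnegrE ?(ltW k0)// invr_ge0.
  by rewrite expr2; lra.
have M1 : M%:R^-1 <= 1 :> R by rewrite invf_le1// ler1n.
have nq2 : n%:R * q <= 2^-1 by apply: le_trans nq _; move: M1; lra.
have := one_plus_expr_le q0 nq2.
set x := (1 + q) ^+ n - 1 => hx.
apply: (@le_trans _ _ (64 * M%:R * (2 * (256^-1 / M%:R)))).
  apply: ler_wpM2l; first by rewrite mulr_ge0.
  by apply: le_trans hx _; rewrite ler_pM2l.
by rewrite (_ : _ * _ = 2^-1); [lra|field; rewrite gt_eqF].
Qed.

Section instance.
Variables (L : R).
Hypotheses (a0 : 0 < alpha) (ab1 : alpha * beta <= 1) (kL : 2 * kappa <= L).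
Variables (T : nat) (dS : measure_display) (S : measurableType dS).
Variables (nu : probability S R) (p : batch_policy R d T S M) (tau : nat -> nat).
Hypotheses (n0 : tau 0%N = 0%N) (nM : (tau M < T)%N).
Hypothesis info : forall j : 'I_M, (tau j)%:R * side j `^ (2 * beta + d%:R) <= M%:R^-1.
Variable Rstar : R.

Lemma in_class_cells (theta : cell_index -> R) (g12 : forall x, `|gap cell_spike theta x| <= 2^-1)
    (delta0 : R) : (forall c, theta c = 0 \/ `|theta c| = 1) ->
  \sum_(c | theta c != 0) side (tag c) `^ (d%:R - alpha * beta) <= 1 ->
  in_class (bern_instance PX (measurable_gap mnn_cell_spike theta) g12)
    alpha beta L (2 * d%:R * kappa^-1 `^ alpha) delta0.
Proof.
move=> t01 mass; apply: (in_class_spike (h := fun c => side (tag c)) (lo := corner)) => //.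
- by move=> c; exact: side_gt0.
- exact: corner_ge0.
- exact: corner_le1.
- exact: cell_spike_disj.
Qed.

Lemma gap_half (theta : cell_index -> R) x : (forall c, `|theta c| <= 1) ->
  `|gap cell_spike theta x| <= 2^-1.
Proof.
move=> t1; apply: (@le_trans _ _ 4^-1); last lra.
exact: (gap_quarter mnn_cell_spike cell_spike_le cell_spike_disj).
Qed.

Lemma single_scale_instance (delta0 : R) : (forall j, (0 < m j)%N) ->
  d%:R - alpha * beta = 0 ->
  (forall j : 'I_M, 16 * M%:R ^+ 2 * Rstar <= slots R T tau j * mass_bound j) ->
  exists B : bandit_instance PX, in_class B alpha beta L (2 * d%:R * kappa^-1 `^ alpha) delta0
    /\ (Rstar%:E <= regret nu p B)%E.
Proof.
move=> m0 dab gain.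
pose cell j : cell_index := Tagged (fun j => 'I_(m j)) (Ordinal (m0 j)).
pose theta (jb : 'I_M * bool) := upd (fun=> 0) (cell jb.1) (pm1 R jb.2).
have t01 jb c : theta jb c = 0 \/ `|theta jb c| = 1.
  rewrite /theta /upd /pm1; case: eqP => _; last by left.
  by right; case: (jb.2); rewrite ?normrN normr1.
have t1 jb c : `|theta jb c| <= 1 by case: (t01 jb c) => ->; rewrite ?normr0.
have sup jb c : theta jb c != 0 -> c == cell jb.1.
  by rewrite /theta /upd; case: ifP => // _; rewrite eqxx.
have [||jb hjb] := average_instance (Rstar := Rstar) (PX := PX) (p := p)
    (hpsi := mnn_cell_spike) nu cell_spike_le cell_spike_disj (theta := theta) _ t1.
- by rewrite card_prod card_ord card_bool muln_gt0 M0.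
- move=> s; apply: (single_scale_regret p mnn_cell_spike cell_spike_le cell_spike_disj s cell_massE cell_chi2E n0 nM M0).
    move=> j; have := cell_chi2_le (c := cell j) (info j).
    set x := (1 + _) ^+ _ - 1 => hx.
    rewrite (_ : 32 * M%:R * x = 2^-1 * (64 * M%:R * x)); last by field.
    lra.
  move=> j; apply: le_trans (gain j) _; apply: ler_wpM2l; last exact: (cell_mass_ge (cell j)).
  by apply: sumr_ge0.
- have g12 x := gap_half x (t1 jb).
  exists (bern_instance PX (measurable_gap mnn_cell_spike (theta jb)) g12).
  split; last exact: hjb.
  apply: in_class_cells => //.
  (* With exponent zero a spike weighs one in the margin budget, and exactly one has a nonzero
     sign. *)
  rewrite dab (eq_bigl (pred1 (cell jb.1))) ?big_pred1_eq ?powRr0// => c.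
  apply/idP/eqP => [/sup/eqP //|->].
  by rewrite /theta /upd eqxx /pm1; case: (jb.2); rewrite ?oppr_eq0 oner_eq0.
Qed.

Lemma multi_scale_instance (delta0 : R) :
  \sum_(j < M) (m j)%:R * side j `^ (d%:R - alpha * beta) <= 1 ->
  (forall j : 'I_M, 16 * M%:R * Rstar <= slots R T tau j * ((m j)%:R * mass_bound j)) ->
  exists B : bandit_instance PX, in_class B alpha beta L (2 * d%:R * kappa^-1 `^ alpha) delta0
    /\ (Rstar%:E <= regret nu p B)%E.
Proof.
move=> mass gain.
pose theta (om : {ffun cell_index -> bool}) c := pm1 R (om c).
have n1 om c : `|theta om c| = 1.
  by rewrite /theta /pm1; case: (om c); rewrite ?normrN normr1.
have t1 om c : `|theta om c| <= 1 by rewrite n1.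
have [||om hom] := average_instance (Rstar := Rstar) (PX := PX) (p := p)
    (hpsi := mnn_cell_spike) nu cell_spike_le cell_spike_disj (theta := theta) _ t1.
- by apply/card_gt0P; exists [ffun=> true].
- move=> s; apply: (multi_scale_regret p mnn_cell_spike cell_spike_le cell_spike_disj s cell_massE cell_chi2E
    n0 nM M0 (act := fun j => [set c : cell_index | tag c == j]%SET)).
    by move=> j c; rewrite inE => /eqP <-; exact: cell_chi2_le (info _).
  move=> j; apply: le_trans (gain j) _; apply: ler_wpM2l; first exact: sumr_ge0.
  apply: (@le_trans _ _ (\sum_(c : cell_index | tag c == j) mass_bound (tag c))).
    rewrite (eq_bigl (fun c : cell_index => (tag c == j) && true)); last by move=> c; rewrite andbT.
    rewrite -(sig_big_dep (pred1 j) (fun j (k : 'I_(m j)) => true) (fun j _ => mass_bound j)) /=.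
    by rewrite big_pred1_eq sumr_const card_ord mulr_natl.
  rewrite [leRHS](eq_bigl (fun c : cell_index => tag c == j)); last by move=> c; rewrite inE.
  by apply: ler_sum => c _; exact: cell_mass_ge.
- have g12 x := gap_half x (t1 om).
  exists (bern_instance PX (measurable_gap mnn_cell_spike (theta om)) g12).
  split; last exact: hom.
  apply: in_class_cells => //; first by move=> c; right; exact: n1.
  apply: le_trans mass.
  rewrite (eq_bigl (fun c : cell_index => true && true)); last first.
    by move=> c; rewrite -normr_eq0 n1 oner_eq0.
  rewrite -(sig_big_dep xpredT (fun j (k : 'I_(m j)) => true)
    (fun j _ => side j `^ (d%:R - alpha * beta))) /=.
  by apply: ler_sum => j _; rewrite sumr_const card_ord mulr_natl.
Qed.

End instance.

End construction.

(** * Choice of the scales *)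

(** Both ends of the window count. The extra one keeps it nonempty when two thresholds coincide, and
    later absorbs the truncation of [threshold j.+1]. *)
Lemma slots_ge {R : realType} (T : nat) (tau : nat -> nat) j :
  (tau j <= (tau j.+1).+1)%N -> (tau j.+1 < T)%N ->
  (tau j.+1)%:R + 1 - (tau j)%:R <= slots R T tau j.
Proof.
move=> jj jT; rewrite natr1 -natrB// /slots sumr_const ler_nat.
have shift (k : 'I_((tau j.+1).+1 - tau j)) : (tau j + k < T)%N.
  by have := ltn_ord k; lia.
pose f k := Ordinal (shift k).
have finj : injective f by move=> k k' [] /addnI /val_inj.
rewrite -[leqLHS](card_ord _) -(fintype.card_image finj).
apply/subset_leq_card/fintype.subsetP => _ /fintype.imageP[k _ ->].
by rewrite unfold_in /=; have := ltn_ord k; lia.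
Qed.

Lemma powR_invl {R : realType} (x r : R) : 0 <= x -> x^-1 `^ r = (x `^ r)^-1.
Proof. by move=> x0; rewrite -{1}(powR_inv1 x0) -powRrM mulN1r powRN. Qed.

Section grid_numbers.
Variables (R : realType) (gamma u : R) (M : nat).
Hypotheses (g0 : 0 < gamma) (g1 : gamma < 1) (u1 : 1 <= u) (M0 : (0 < M)%N).

(** The solution of [level j.+1 = Q * level j^gamma] with [level 0 = 1] and [level M = u]; the final
    value forces [Q = u^((1 - gamma) / (1 - gamma^M))], the rate to be proved. *)
Definition level j : R := u `^ ((1 - gamma ^+ j) / (1 - gamma ^+ M)).

Let gM : 0 < 1 - gamma ^+ M.
Proof. by rewrite subr_gt0 exprn_ilt1 -?lt0n// ltW. Qed.

Lemma level0 : level 0 = 1.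
Proof. by rewrite /level expr0 subrr mul0r powRr0. Qed.

Lemma levelM : level M = u.
Proof. by rewrite /level divff ?gt_eqF// powRr1// (le_trans ler01). Qed.

Lemma levelS j : level j.+1 = u `^ ((1 - gamma) / (1 - gamma ^+ M)) * level j `^ gamma.
Proof.
have un0 : u != 0 by rewrite gt_eqF// (lt_le_trans ltr01).
rewrite /level -powRrM -powRD ?un0 ?implybT//.
by congr (_ `^ _); rewrite exprS; field; rewrite gt_eqF.
Qed.

Lemma level_le i j : (i <= j)%N -> level i <= level j.
Proof.
move=> ij; apply: ler_powR => //; apply: ler_wpM2r; first by rewrite invr_ge0 ltW.
by rewrite lerD2l lerN2; apply: ler_wiXn2l => //; exact: ltW.
Qed.

Lemma level_ge1 j : 1 <= level j.
Proof. by rewrite -level0 level_le. Qed.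

(* The factor [(j + 1) / (M + 2)] separates consecutive thresholds by at least
   [level / (M + 2)], however large [M] is, and makes the last one less than [u]. *)
Definition scaled_level j : R := level j * j.+1%:R / M.+2%:R.

Definition threshold j : nat := Num.truncn (scaled_level j).

Lemma scaled_level_ge0 j : 0 <= scaled_level j.
Proof. by rewrite divr_ge0// mulr_ge0// (le_trans ler01) ?level_ge1. Qed.

Lemma threshold_itv j : (threshold j)%:R <= scaled_level j < (threshold j)%:R + 1.
Proof. by rewrite natr1; apply: truncn_itv; exact: scaled_level_ge0. Qed.

Lemma threshold0 : threshold 0 = 0%N.
Proof.
apply/eqP; rewrite -leqn0 -ltnS -(ltr_nat R).
have /andP[+ _] := threshold_itv 0; rewrite /scaled_level level0 mul1r => h.
by apply: le_lt_trans h _; rewrite ltr_pdivrMr ?ltr0n// mul1r ltr_nat.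
Qed.

Lemma threshold_lt T : u = T%:R -> (threshold M < T)%N.
Proof.
move=> uT; rewrite -(ltr_nat R) -uT.
have /andP[+ _] := threshold_itv M; rewrite /scaled_level levelM => h.
apply: le_lt_trans h _; rewrite ltr_pdivrMr ?ltr0n// ltr_pM2l ?ltr_nat//.
exact: lt_le_trans u1.
Qed.

Lemma scaled_level_step j : level j.+1 / M.+2%:R <= scaled_level j.+1 - scaled_level j.
Proof.
rewrite /scaled_level -mulrBl; apply: ler_wpM2r; first by rewrite invr_ge0.
have : level j * j.+1%:R <= level j.+1 * j.+1%:R by rewrite ler_wpM2r// level_le.
by rewrite -[j.+2%:R]natr1; lra.
Qed.

Lemma threshold_le j : (j <= M)%N -> (threshold j)%:R <= level j.
Proof.
move=> jM; have /andP[h _] := threshold_itv j; apply: le_trans h _.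
rewrite /scaled_level ler_pdivrMr ?ltr0n// ler_wpM2l ?ler_nat//; last by lia.
exact: le_trans ler01 (level_ge1 j).
Qed.

Lemma threshold_mono i j : (i <= j)%N -> (threshold i <= threshold j)%N.
Proof.
elim: j => [|j IH]; first by rewrite leqn0 => /eqP ->.
rewrite leq_eqVlt => /orP[/eqP -> //|ij]; apply: leq_trans (IH ij) _.
apply: le_truncn; have := scaled_level_step j.
have : 0 <= level j.+1 / M.+2%:R by rewrite divr_ge0// (le_trans ler01) ?level_ge1.
by move=> h1 h2; rewrite -subr_ge0 (le_trans h1).
Qed.

Lemma threshold_slots T j : u = T%:R -> (j < M)%N ->
  level j.+1 / (3 * M%:R) <= slots R T threshold j.
Proof.
move=> uT jM.
have Mp : 0 < M%:R :> R by rewrite ltr0n.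
have t1 : (threshold j <= (threshold j.+1).+1)%N by apply: leqW; exact: threshold_mono.
have t2 : (threshold j.+1 < T)%N.
  by apply: leq_ltn_trans (threshold_lt uT); exact: threshold_mono.
apply: le_trans (slots_ge t1 t2).
have /andP[h1 h2] := threshold_itv j; have /andP[h3 h4] := threshold_itv j.+1.
have h5 := scaled_level_step j.
apply: (@le_trans _ _ (level j.+1 / M.+2%:R)); last first.
  by apply: le_trans h5 _; lra.
apply: ler_wpM2l; first exact: le_trans ler01 (level_ge1 _).
rewrite lef_pV2 ?posrE ?ltr0n ?mulr_gt0//.
by rewrite -natrM ler_nat; lia.
Qed.

End grid_numbers.

(** * Side lengths of the spikes *)

Section scale_numbers.
Variables (R : realType) (U D : R) (M a : nat).
Hypotheses (U1 : 1 <= U) (M0 : (0 < M)%N) (D1 : 1 <= D).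

(* The factor [M ^ a] makes each spike so small that the [M] scales can share the
   mass allowed by the margin condition, see [mesh_inv_powR_ge]. *)
Definition resolution : nat := (Num.truncn (M%:R ^+ a * U `^ D^-1)).+1.

Definition mesh : R := (M * resolution)%:R^-1.

Let y := M%:R ^+ a * U `^ D^-1.

Let M1 : 1 <= M%:R :> R. Proof. by rewrite ler1n. Qed.

Let Mp : 0 < M%:R :> R. Proof. by rewrite ltr0n. Qed.

Let D0 : 0 < D. Proof. exact: lt_le_trans D1. Qed.

Let Ma1 : 1 <= M%:R ^+ a :> R. Proof. exact: exprn_ege1. Qed.

Let V1 : 1 <= U `^ D^-1.
Proof. by rewrite -[leLHS](powRr0 U) ler_powR// invr_ge0 ltW. Qed.

Let y1 : 1 <= y. Proof. by rewrite -[leLHS]mulr1 ler_pM. Qed.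

Lemma resolution_itv : y < resolution%:R <= 2 * y.
Proof.
have y0 : 0 <= y by exact: le_trans ler01 y1.
have /andP[h1 h2] := truncn_itv y0; rewrite h2 /=.
by rewrite /resolution -natr1 mulr_natl mulr2n lerD.
Qed.

Lemma mesh_gt0 : 0 < mesh.
Proof. by rewrite invr_gt0 ltr0n muln_gt0 M0. Qed.

Lemma mesh_le_inv (t : R) : 0 < t -> t <= M%:R * y -> mesh <= t^-1.
Proof.
move=> t0 ty; rewrite lef_pV2 ?posrE//; last by rewrite ltr0n muln_gt0 M0.
apply: le_trans ty _; rewrite natrM ler_pM2l//; have /andP[h _] := resolution_itv.
exact: ltW.
Qed.

Lemma mesh_ge : (2 * M%:R ^+ a.+1 * U `^ D^-1)^-1 <= mesh.
Proof.
have /andP[_ h] := resolution_itv.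
rewrite lef_pV2 ?posrE ?mulr_gt0 ?exprn_gt0 ?(lt_le_trans ltr01 V1)//; last first.
  by rewrite ltr0n muln_gt0 M0.
rewrite natrM exprS [leRHS](_ : _ = M%:R * (2 * y)); last by rewrite /y; ring.
by rewrite ler_pM2l.
Qed.

(** [mesh] is at most [1 / (M * U^(1/D))], whose power [D] is [M^(-D) / U]; since [D >= 1], one
    factor [1/M] is gained. *)
Lemma mesh_info : U * mesh `^ D <= M%:R^-1.
Proof.
have U0 : 0 < U by exact: lt_le_trans U1.
have V0 : 0 < U `^ D^-1 by rewrite powR_gt0.
have : mesh <= (M%:R * U `^ D^-1)^-1.
  apply: mesh_le_inv; first by rewrite mulr_gt0.
  by rewrite ler_pM2l// /y ler_peMl// ltW.
have MV0 : 0 <= (M%:R * U `^ D^-1)^-1 by rewrite invr_ge0 mulr_ge0// ltW.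
move=> /(ge0_ler_powR (ltW D0) (ltW mesh_gt0) MV0) h.
apply: (@le_trans _ _ (U * (M%:R * U `^ D^-1)^-1 `^ D)).
  by rewrite ler_pM2l.
rewrite invfM powRM ?invr_ge0//; last exact: ltW.
rewrite [X in _ * (_ * X)](_ : _ = U^-1); last first.
  by rewrite powR_invl ?powR_ge0// -powRrM mulVf ?gt_eqF// powRr1// ltW.
rewrite mulrCA mulfV ?gt_eqF// mulr1.
rewrite -[leRHS]powRr1 ?invr_ge0//.
apply: ger_powR => //; rewrite invr_gt0 Mp /= invf_le1//.
Qed.

Lemma mesh_powR_ge (eta : R) : 0 <= eta ->
  2 `^ (- eta) * M%:R^-1 `^ (a.+1%:R * eta) / U `^ (eta / D) <= mesh `^ eta.
Proof.
move=> eta0; have U0 : 0 < U by exact: lt_le_trans U1.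
have V0 : 0 < U `^ D^-1 by rewrite powR_gt0.
have N0 : 0 <= (2 * M%:R ^+ a.+1 * U `^ D^-1)^-1.
  by rewrite invr_ge0 !mulr_ge0 ?exprn_ge0// ltW.
have := ge0_ler_powR eta0 N0 (ltW mesh_gt0) mesh_ge; apply: le_trans.
rewrite !invfM !powRM ?invr_ge0 ?mulr_ge0 ?invr_ge0 ?exprn_ge0 ?(ltW V0)//.
rewrite le_eqVlt; apply/orP; left; apply/eqP; congr (_ * _ * _).
- by rewrite powR_invl// powRN.
- by rewrite powRrM powR_mulrn ?invr_ge0// exprVn.
- by rewrite powR_invl ?powR_ge0// -powRrM mulrC.
Qed.

(** From [mesh <= M^(-a)]. It makes the number [mesh^(- r) / M] of spikes allotted to one scale at
    least one. *)
Lemma mesh_inv_powR_ge (r : R) : 0 <= r -> 1 <= a%:R * r -> M%:R <= mesh `^ (- r).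
Proof.
move=> r0 ar; have h : mesh <= (M%:R ^+ a)^-1.
  apply: mesh_le_inv; first by rewrite exprn_gt0.
  rewrite /y mulrCA ler_peMr ?exprn_ge0// -[leLHS]mulr1 ler_pM//.
rewrite powRN -[leLHS]invrK lef_pV2 ?posrE ?invr_gt0 ?powR_gt0 ?mesh_gt0//.
have A0 : 0 <= (M%:R ^+ a)^-1 :> R by rewrite invr_ge0 exprn_ge0.
apply: le_trans (ge0_ler_powR r0 (ltW mesh_gt0) A0 h) _.
rewrite -exprVn -powR_mulrn ?invr_ge0// -powRrM -[leRHS]powRr1 ?invr_ge0//.
by apply: ger_powR => //; rewrite invr_gt0 Mp /= invf_le1.
Qed.

End scale_numbers.

Lemma mass_ge {R : realType} (h kappa beta : R) d : 0 < h -> 0 < kappa -> 0 < beta <= 1 ->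
  kappa / (4 * 2 ^+ d) * h `^ (beta + d%:R) <= kappa * (h / 4) `^ beta * (h / 2) ^+ d.
Proof.
move=> h0 k0 /andP[b0 b1].
rewrite powRD ?(gt_eqF h0) ?implybT// powR_mulrn ?(ltW h0)// expr_div_n.
rewrite powRM ?(ltW h0)// powR_invl//.
have e4 : 4^-1 <= (4 `^ beta)^-1 :> R.
  by rewrite lef_pV2 ?posrE ?powR_gt0//; apply: ler1_powR => //; lra.
rewrite invfM [leLHS](_ : _ = (kappa * h `^ beta * (h ^+ d / 2 ^+ d)) * 4^-1); last by ring.
rewrite [leRHS](_ : _ = (kappa * h `^ beta * (h ^+ d / 2 ^+ d)) * (4 `^ beta)^-1); last by ring.
by rewrite ler_wpM2l// !mulr_ge0 ?invr_ge0 ?exprn_ge0 ?powR_ge0 ?(ltW h0) ?(ltW k0).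
Qed.

Theorem theorem2 (R : realType) (d : nat) (alpha beta L : R) (hd : (1 <= d)%N)
    (hbeta : 0 < beta <= 1) (halpha : 0 < alpha) (hab : alpha * beta <= 1)
    (hL : 0 < L) :
  let gamma := beta * (1 + alpha) / (2 * beta + d%:R) in
  exists D0 delta0 D1 D2 : R,
    [/\ 0 < D0, 0 < delta0 < 1, 0 < D1 & 0 < D2] /\
    forall T M : nat, (1 <= M <= T)%N ->
    forall (dS : measure_display) (S : measurableType dS)
      (nu : probability S R) (p : batch_policy R d T S M),
    exists B : bandit_instance (uniform_cube R d),
      in_class B alpha beta L D0 delta0 /\
      ((D1 * (1 / M%:R) `^ D2 * T%:R `^ ((1 - gamma) / (1 - gamma ^+ M)))%:E
        <= regret nu p B)%E.
Proof.
move=> gamma; have [b0 b1] := andP hbeta.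
have d1 : 1 <= d%:R :> R by rewrite ler1n.
pose D := 2 * beta + d%:R; pose eta := beta * (1 + alpha).
have D1' : 1 <= D by rewrite /D; lra.
have D0' : 0 < D by exact: lt_le_trans D1'.
have eta0 : 0 < eta by rewrite mulr_gt0// addr_gt0.
have g0 : 0 < gamma by rewrite divr_gt0.
have g1 : gamma < 1.
  by rewrite ltr_pdivrMr// mul1r /D mulrDr mulr1 [beta * alpha]mulrC; lra.
pose r : R := d%:R - alpha * beta.
have r0 : 0 <= r by rewrite subr_ge0; exact: le_trans hab d1.
(* The exponent in [resolution]; it depends only on [d], [alpha] and [beta], hence so does the power
   of [M] in the final bound. *)
have [a ar] : exists a : nat, 0 < r -> 1 <= a%:R * r.
  have [rp|rn] := ltP 0 r; last by exists 0%N.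
  exists (Num.truncn r^-1).+1 => _; rewrite -ler_pdivrMr// div1r.
  have ri : 0 <= r^-1 by rewrite invr_ge0 ltW.
  by have /andP[_ /ltW] := truncn_itv ri.
(* The first bound controls the chi-square distance, the second the smoothness. *)
pose kappa := Num.min 32^-1 (L / 2).
have k0 : 0 < kappa by rewrite lt_min invr_gt0 ltr0n divr_gt0.
have k1 : kappa <= 32^-1 by rewrite ge_min lexx.
have kL : 2 * kappa <= L.
  have : kappa <= L / 2 by rewrite ge_min lexx orbT.
  lra.
pose c0 := kappa / (4 * 2 ^+ d) * 2 `^ (- eta).
have c00 : 0 < c0 by rewrite mulr_gt0 ?powR_gt0// divr_gt0// mulr_gt0// exprn_gt0.
(* The constant [96] is [16 * 3 * 2]: the averaging bound, the window length and the rounding of the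
   number of spikes. The exponent 4 collects [M^2] from the averaging bound, one [M] from the window
   length and one from sharing the margin budget; the rest of the exponent comes from the mesh. *)
exists (2 * d%:R * kappa^-1 `^ alpha), 2^-1, (c0 / 96), (4 + a.+1%:R * eta).
split.
  split => //; first by rewrite !mulr_gt0 ?powR_gt0 ?invr_gt0// (lt_le_trans ltr01).
  - lra.
  - by rewrite divr_gt0.
  - by rewrite addr_gt0// mulr_gt0.
move=> T M /andP[M0 MT] dS S nu p.
have Mp : 0 < M%:R :> R by rewrite ltr0n.
have T1 : 1 <= T%:R :> R by rewrite ler1n (leq_trans M0).
pose U := level gamma T%:R M.
have U1 j : 1 <= U j by exact: (level_ge1 g0 g1 T1 M0).
pose Q := T%:R `^ ((1 - gamma) / (1 - gamma ^+ M)).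
pose z (j : 'I_M) := resolution (U j) D M a.
pose h (j : 'I_M) : R := mesh (U j) D M a.
have h0 j : 0 < h j by exact: mesh_gt0.
(* This many spikes of side [h j] use exactly the share [1 / M] of the margin budget. When [r = 0]
   it is at most one, and one spike per scale is prepared instead. *)
pose x j := h j `^ (- r) / M%:R.
pose m j := if 0 < r then Num.truncn (x j) else 1%N.
have x1 j : 0 < r -> 1 <= x j.
  by move=> rp; rewrite ler_pdivlMr// mul1r; apply: mesh_inv_powR_ge => //; exact: ar.
have m0 j : (0 < m j)%N.
  by rewrite /m; case: ltP => // rp; rewrite truncn_gt0 x1.
have mx j : x j / 2 <= (m j)%:R.
  rewrite /m; case: ltP => rp.
    have x0 : 0 <= x j by exact: le_trans ler01 (x1 j rp).
    have /andP[_] := truncn_itv x0; rewrite -natr1.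
    have : 1 <= (Num.truncn (x j))%:R :> R by rewrite ler1n truncn_gt0 x1.
    lra.
  have -> : x j = M%:R^-1.
    by rewrite /x (_ : r = 0) ?oppr0 ?powRr0 ?mul1r//; apply/le_anti; rewrite rp r0.
  have : M%:R^-1 <= 1 :> R by rewrite invf_le1// ler1n.
  lra.
pose Rstar := c0 / 96 * (1 / M%:R) `^ (4 + a.+1%:R * eta) * Q.
have Rstar0 : 0 <= Rstar by rewrite !mulr_ge0 ?powR_ge0 ?invr_ge0// ltW.
pose tau := threshold gamma T%:R M.
have gain (j : 'I_M) : 16 * M%:R ^+ 2 * Rstar <= slots R T tau j *
    ((m j)%:R * mass_bound d beta kappa z j).
  have sl : U j.+1 / (3 * M%:R) <= slots R T tau j
    by apply: (threshold_slots g0 g1 T1 M0).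
  have mass := mass_ge d (h0 j) k0 hbeta; rewrite -/(mass_bound d beta kappa z j) in mass.
  have U0 : 0 < U j by exact: lt_le_trans (U1 j).
  have cell : kappa / (4 * 2 ^+ d) * h j `^ eta / (2 * M%:R) <=
      (m j)%:R * mass_bound d beta kappa z j.
    have -> : kappa / (4 * 2 ^+ d) * h j `^ eta / (2 * M%:R) =
        x j / 2 * (kappa / (4 * 2 ^+ d) * h j `^ (beta + d%:R)).
      have -> : h j `^ eta = h j `^ (- r) * h j `^ (beta + d%:R).
        rewrite -powRD ?(gt_eqF (h0 j)) ?implybT//; congr (_ `^ _).
        by rewrite /eta /r; ring.
      by rewrite /x; field; rewrite ?expf_neq0 ?gt_eqF.
    apply: ler_pM => //.
      by rewrite !mulr_ge0 ?invr_ge0 ?powR_ge0// ltW.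
    by rewrite !mulr_ge0 ?powR_ge0 ?invr_ge0 ?mulr_ge0 ?exprn_ge0// ltW.
  have hge := mesh_powR_ge a (U1 j) M0 D1' (ltW eta0).
  rewrite -/(h j) in hge.
  (* Since [gamma = eta / D], the lower bound on [h j^eta] contains [U j^(- gamma)]; it cancels the
     power of [U j] here, leaving [Q] for every [j]. *)
  have UQ : U j.+1 = Q * U j `^ gamma by exact: (levelS g0 g1 T1 M0 j).
  have Ug0 : 0 < U j `^ gamma by exact: powR_gt0.
  set W := M%:R^-1 `^ (a.+1%:R * eta) in hge.
  have {}hge : 2 `^ (- eta) * W / U j `^ gamma <= h j `^ eta by exact: hge.
  have W0 : 0 <= W by exact: powR_ge0.
  have Q0 : 0 <= Q by exact: powR_ge0.
  have RE : Rstar = c0 / 96 * (M%:R^-1 ^+ 4 * W) * Q.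
    rewrite /Rstar div1r powRD; last by rewrite invr_eq0 (gt_eqF Mp) implybT.
    by rewrite powR_mulrn ?invr_ge0// -/W.
  apply: (@le_trans _ _ (U j.+1 / (3 * M%:R) *
      (kappa / (4 * 2 ^+ d) * h j `^ eta / (2 * M%:R)))); last first.
    apply: ler_pM => //.
      by rewrite divr_ge0 ?mulr_ge0// (le_trans ler01).
    by rewrite !mulr_ge0 ?powR_ge0 ?invr_ge0 ?mulr_ge0 ?exprn_ge0// ltW.
  apply: (@le_trans _ _ (U j.+1 / (3 * M%:R) *
      (kappa / (4 * 2 ^+ d) * (2 `^ (- eta) * W / U j `^ gamma) / (2 * M%:R)))); last first.
    apply: ler_wpM2l; first by rewrite divr_ge0 ?mulr_ge0// (le_trans ler01).
    apply: ler_wpM2r; first by rewrite invr_ge0 mulr_ge0.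
    by apply: ler_wpM2l => //; rewrite divr_ge0 ?mulr_ge0 ?exprn_ge0// ltW.
  rewrite RE UQ le_eqVlt; apply/orP; left; apply/eqP.
  rewrite /c0; field.
  by rewrite ?expf_neq0 ?gt_eqF.
have cells (j : 'I_M) : exists v : 'I_(m j) -> 'I_d -> nat,
    [/\ forall k k', k != k' -> exists i, v k i != v k' i,
        forall k i, (v k i < M * z j)%N &
        forall k (i : 'I_d), val i = 0%N -> (j * z j <= v k i < j.+1 * z j)%N].
  apply: grid_cells => //; first by rewrite leq_mul2r ltn_ord orbT.
  have z1 : (0 < z j)%N by [].
  rewrite /m; case: ltP => rp; last by rewrite muln_gt0 z1 expn_gt0 muln_gt0 M0 z1.
  rewrite -(ler_nat R); have x0 : 0 <= x j by exact: le_trans ler01 (x1 j rp).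
  have /andP[+ _] := truncn_itv x0; move=> /le_trans; apply.
  (* The slab has [z j * (M * z j)^(d - 1) = h j^(- d) / M] cells, enough for [h j^(- r) / M] spikes
     because [r <= d] and [h j <= 1]. *)
  have MzE : (M * z j)%:R = (h j)^-1 by rewrite /h /mesh invrK.
  have zE : (z j)%:R = (h j)^-1 / M%:R by rewrite -MzE natrM mulrC mulKf ?gt_eqF.
  rewrite natrM natrX MzE zE /x mulrAC ler_wpM2r ?invr_ge0//.
  rewrite -exprS prednK// -powR_mulrn ?invr_ge0 ?(ltW (h0 j))// powR_invl ?(ltW (h0 j))//.
  rewrite -powRN; apply: ger_powR.
    by rewrite h0 /= invf_le1 ?ltr0n ?muln_gt0 ?M0// ler1n muln_gt0 M0.
  by rewrite lerN2 /r lerBlDr lerDl mulr_ge0// ltW.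
pose v (j : 'I_M) := sval (cid (cells j)).
have vP (j : 'I_M) := svalP (cid (cells j)).
have info (j : 'I_M) : (tau j)%:R * side R z j `^ (2 * beta + d%:R) <= M%:R^-1.
  apply: le_trans (mesh_info a (U1 j) M0 D1'); apply: ler_wpM2r; first exact: powR_ge0.
  exact: (threshold_le g0 g1 T1 M0 (ltnW (ltn_ord j))).
have z0 (j : 'I_M) : (0 < z j)%N by [].
have n0 : tau 0%N = 0%N by exact: (threshold0 g0 g1 T1 M0).
have nM : (tau M < T)%N by exact: (threshold_lt g0 g1 T1 M0).
have vinj (j : 'I_M) (k k' : 'I_(m j)) : k != k' -> exists i, v j k i != v j k' i by case: (vP j) => + _ _; apply.
have vlt (j : 'I_M) (k : 'I_(m j)) i : (v j k i < M * z j)%N by case: (vP j) => _ + _; apply.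
have vslab (j : 'I_M) (k : 'I_(m j)) (i : 'I_d) : val i = 0%N -> (j * z j <= v j k i < j.+1 * z j)%N.
  by case: (vP j) => _ _; apply.
have [rp|rn] := ltP 0 r.
  apply: (multi_scale_instance hd z0 M0 vinj vlt vslab k0 k1 hbeta halpha hab kL
    nu p n0 nM info) => //.
    apply: (@le_trans _ _ (\sum_(j < M) M%:R^-1)).
      apply: ler_sum => j _; rewrite -/r.
      apply: (@le_trans _ _ (x j * h j `^ r)).
        apply: ler_wpM2r; first exact: powR_ge0.
        have x0 : 0 <= x j by exact: le_trans ler01 (x1 j rp).
        by rewrite /m rp; have /andP[] := truncn_itv x0.
      by rewrite /x powRN mulrAC mulVf ?mul1r// gt_eqF// powR_gt0.
    by rewrite sumr_const card_ord -[_ *+ M]mulr_natr mulVf ?gt_eqF.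
  move=> j; apply: le_trans (gain j); apply: ler_wpM2r => //.
  (* [gain] is stated with the [M^2] of the single-spike case; averaging over sign patterns asks
     only for [M]. *)
  by rewrite ler_pM2l// ler_eXnr// ler1n.
apply: (single_scale_instance hd z0 M0 vinj vlt vslab k0 k1 hbeta halpha hab kL
  nu p n0 nM info) => //.
  by apply/le_anti; rewrite rn r0.
move=> j; apply: le_trans (gain j) _.
by rewrite /m ltNge rn /= mul1r.
Qed.
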